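(* Let $n\ge 2$, let $\Omega\subseteq\mathbb{R}^n$ be a bounded domain with Lipschitz boundary, and let $\mathbf{b}\in\mathrm{Lip}(\Omega)^n$. Suppose that there exists an orthonormal frame $\mathbf{b}_1,\ldots,\mathbf{b}_n\in\mathrm{Lip}(\Omega)^n$ (i.e. $\mathbf{b}_1(x),\dots,\mathbf{b}_n(x)$ is an orthonormal basis of $\mathbb{R}^n$ for every $x\in\Omega$) such that $\mathbf{b}_1=\mathbf{b}$ and such that $\mathbf{b}_n$ is the restriction to $\Omega$ of a vector field (still denoted $\mathbf{b}_n$) in $C^1(\mathbb{R}^n;\mathbb{R}^n)$ with bounded differential for which there exist $w\in\mathbb{R}^n$ and $\alpha>0$ with $\mathbf{b}_n(x)\cdot w\ge\alpha>0$ for all $x\in\mathbb{R}^n$. Then there exists $C_P>0$, depending on $\Omega$, $\mathbf{b}_n$ and $\alpha$, such that $$\|v\|_{L^2(\Omega)}\le C_P\|\nabla_\perp v\|_{L^2(\Omega)}\qquad\text{for all } v\in H^1_{\perp,0}(\Omega).$$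
   Context: $\nabla_\perp v:=\nabla v-\mathbf b(\mathbf b\cdot\nabla v)=(\mathrm{Id}-\mathbf b\mathbf b^\top)\nabla v$, understood in the sense of distributions for $v\in L^2(\Omega)$. $H^1_\perp(\Omega):=\{v\in L^2(\Omega):\nabla_\perp v\in L^2(\Omega)^n\}$ with its natural graph norm, and $H^1_{\perp,0}(\Omega)$ is the closure of $\mathcal D(\Omega)=C_c^\infty(\Omega)$ in $H^1_\perp(\Omega)$. *)

(* Defs.v *)
From HB Require Import structures.
From mathcomp Require Import all_boot all_order all_algebra.
From mathcomp Require Import all_classical all_reals all_analysis.

Set Implicit Arguments.
Unset Strict Implicit.
Unset Printing Implicit Defensive.

Import Order.TTheory GRing.Theory Num.Theory.
Import numFieldTopology.Exports numFieldNormedType.Exports.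

Local Open Scope classical_set_scope.
Local Open Scope ring_scope.

(* Borel sigma-algebra and Lebesgue measure on R^n, represented by row vectors.
   The sigma-algebra is the one generated by the coordinate functions, as for
   the tuples of measurable_structure.v. *)
Definition rV_display : measure_display.
Proof. exact: default_measure_display. Qed.

Section measurable_rV.
Variables (R : realType) (n : nat).

Definition rV_coord (i : 'I_n) (x : 'rV[R]_n) : measurableTypeR R := x ord0 i.

Let rV_set0 : g_sigma_preimage rV_coord set0.
Proof. exact: sigma_algebra0. Qed.

Let rV_setC A : g_sigma_preimage rV_coord A -> g_sigma_preimage rV_coord (~` A).
Proof. exact: sigma_algebraC. Qed.

Let rV_bigcup (F : _^nat) : (forall i, g_sigma_preimage rV_coord (F i)) ->
  g_sigma_preimage rV_coord (\bigcup_i (F i)).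
Proof. exact: sigma_algebra_bigcup. Qed.

HB.instance Definition _ := @isMeasurable.Build rV_display
  'rV[R]_n (g_sigma_preimage rV_coord) rV_set0 rV_setC rV_bigcup.

Lemma measurable_rV_coord (i : 'I_n) : measurable_fun [set: 'rV[R]_n] (rV_coord i).
Proof.
move=> _ Y mY; rewrite setTI; apply: sub_sigma_algebra => /=.
rewrite -bigcup_seq/=; exists i => /=; first by rewrite mem_index_enum.
by exists Y => //; rewrite setTI.
Qed.

Lemma measurable_fun_rV d (T : measurableType d) (f : T -> 'rV[R]_n) :
  (forall i, measurable_fun [set: T] (rV_coord i \o f)) ->
  measurable_fun [set: T] f.
Proof.
move=> mf _ Y mY; rewrite setTI.
suff: g_sigma_preimage (fun i => rV_coord i \o f) `<=` measurable.
  apply; rewrite g_sigma_preimage_comp.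
  by exists Y => //; rewrite setTI.
apply: smallest_sub; first exact: sigma_algebra_measurable.
rewrite -bigcup_seq; apply: bigcup_sub => i _ A [B mB <-].
exact: mf.
Qed.

End measurable_rV.

Section rV_cons.
Variables (R : realType) (n : nat).

Definition rV_cons (p : measurableTypeR R * 'rV[R]_n) : 'rV[R]_n.+1 :=
  row_mx (const_mx p.1 : 'rV[R]_1) p.2.

Definition rV_uncons (x : 'rV[R]_n.+1) : measurableTypeR R * 'rV[R]_n :=
  (x ord0 ord0, rsubmx (x : 'rV[R]_(1 + n))).

Lemma rV_consK : cancel rV_cons rV_uncons.
Proof.
move=> [a v]; rewrite /rV_cons /rV_uncons /=; congr pair; last first.
  exact: row_mxKr.
have := row_mxEl (const_mx a : 'rV[R]_1) v ord0 ord0; rewrite [RHS]mxE.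
by apply: etrans; congr (row_mx _ _ _ _); exact/val_inj.
Qed.

Lemma measurable_rV_cons : measurable_fun setT rV_cons.
Proof.
apply: measurable_fun_rV => i; case: (split_ordP (i : 'I_(1 + n))) => j ->.
  rewrite (_ : _ \o _ = fst); first exact: measurable_fst.
  apply/funext => -[a v]; rewrite /rV_coord /rV_cons /=.
  by apply: etrans (row_mxEl _ _ _ _) _; rewrite mxE.
rewrite (_ : _ \o _ = rV_coord j \o snd); last first.
  by apply/funext => -[a v]; exact: row_mxEr.
exact: (measurableT_comp (measurable_rV_coord j) measurable_snd).
Qed.

Lemma measurable_rV_uncons : measurable_fun setT rV_uncons.
Proof.
apply: measurable_fun_pair => /=.
  exact: measurable_rV_coord.
apply: measurable_fun_rV => i; rewrite /rV_coord /comp/=.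
under eq_fun do rewrite mxE.
exact: measurable_rV_coord.
Qed.

End rV_cons.

Section lebesgue_rV_succ.
Variables (R : realType) (n : nat).
Variable m : {sigma_finite_measure set 'rV[R]_n -> \bar R}.

Definition lebesgue_rV_succ : set 'rV[R]_n.+1 -> \bar R :=
  pushforward (@lebesgue_measure R \x m)%E (@rV_cons R n).

HB.instance Definition _ := @isMeasurableFun.Build _ _ _ _ (@rV_cons R n)
  (@measurable_rV_cons R n).

Let succ0 : lebesgue_rV_succ set0 = 0%E.
Proof. exact: measure0. Qed.

Let succ_ge0 A : (0 <= lebesgue_rV_succ A)%E.
Proof. exact: measure_ge0. Qed.

Let succ_sigma_additive : semi_sigma_additive lebesgue_rV_succ.
Proof. exact: measure_semi_sigma_additive. Qed.

HB.instance Definition _ := isMeasure.Build _ _ _ lebesgue_rV_succ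
  succ0 succ_ge0 succ_sigma_additive.

Let succ_sigma_finite : sigma_finite setT lebesgue_rV_succ.
Proof.
have /sigma_finiteP[F [TF ndF Foo]] := sigma_finiteT (@lebesgue_measure R).
have /sigma_finiteP[G [TG ndG Goo]] := sigma_finiteT m.
exists (fun k => @rV_uncons R n @^-1` (F k `*` G k)) => [|k].
  apply/esym; rewrite -subTset => x _.
  have [i _ Fi] : (\bigcup_i F i) (rV_uncons x).1 by rewrite -TF.
  have [j _ Gj] : (\bigcup_i G i) (rV_uncons x).2 by rewrite -TG.
  exists (maxn i j) => //; split.
  - by move: Fi; exact/subsetPset/ndF/leq_maxl.
  - by move: Gj; exact/subsetPset/ndG/leq_maxr.
have [mF Fk] := Foo k; have [mG Gk] := Goo k; split.
  rewrite -[X in measurable X]setTI; apply: measurable_rV_uncons => //.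
  exact: measurableX.
rewrite /lebesgue_rV_succ /pushforward -comp_preimage.
rewrite (_ : _ \o _ = id) ?preimage_id; last first.
  by apply/funext => x /=; rewrite rV_consK.
by rewrite product_measure1E// lte_mul_pinfty// ge0_fin_numE.
Qed.

HB.instance Definition _ := Measure_isSigmaFinite.Build _ _ _ lebesgue_rV_succ
  succ_sigma_finite.

End lebesgue_rV_succ.

Fixpoint lebesgue_rV (R : realType) (n : nat) :
    {sigma_finite_measure set 'rV[R]_n -> \bar R} :=
  match n with
  | 0 => \d_(0 : 'rV[R]_0)
  | k.+1 => lebesgue_rV_succ (lebesgue_rV R k)
  end.

Lemma measurable_rV_box (R : realType) n (A : 'I_n -> set (measurableTypeR R)) :
  (forall i, measurable (A i)) ->
  measurable [set x : 'rV[R]_n | forall i, A i (rV_coord i x)].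
Proof.
move=> mA; rewrite (_ : mkset _ = \bigcap_(i in [set: 'I_n]) (@rV_coord R n i @^-1` A i)).
  apply: fin_bigcap_measurable => // i _.
  by rewrite -[X in measurable X]setTI; exact: measurable_rV_coord.
by apply/seteqP; split => x Ax i //=; exact: (Ax i).
Qed.

Lemma lebesgue_rV_box (R : realType) n (A : 'I_n -> set (measurableTypeR R)) :
  (forall i, measurable (A i)) ->
  lebesgue_rV R n [set x | forall i, A i (rV_coord i x)] =
  (\prod_(i < n) lebesgue_measure (A i))%E.
Proof.
elim: n A => [|n ih] A mA.
  by rewrite big_ord0 /= diracE mem_set// => -[].
rewrite big_ord_recl /= /lebesgue_rV_succ /pushforward -ih//.
have mB := @measurable_rV_box R n _ (fun i => mA (lift ord0 i)).
rewrite -product_measure1E//.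
have c0 (a : R) (v : 'rV[R]_n) : rV_coord ord0 (rV_cons (a, v)) = a.
  by have /(congr1 fst) := @rV_consK R n (a, v).
have cS (a : R) (v : 'rV[R]_n) i : rV_coord (lift ord0 i) (rV_cons (a, v)) = rV_coord i v.
  rewrite /rV_coord /rV_cons (_ : lift ord0 i = rshift 1 i); last exact/val_inj.
  exact: row_mxEr.
congr ((_ \x _)%E _); apply/seteqP; split => -[a v] /=.
  by move=> Av; split => [|i]; [rewrite -(c0 a v)|rewrite -(cS a v)].
by move=> [Aa Av] i; case: (unliftP ord0 i) => [j|] ->; rewrite ?c0 ?cS.
Qed.

Section euclidean.
Variables (R : realType) (n : nat).
Implicit Types u v : 'rV[R]_n.

Definition dot u v : R := \sum_i u ord0 i * v ord0 i.

(* The norm `|u| of the library is the sup norm. *)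
Definition enorm u : R := Num.sqrt (dot u u).

Definition basis_vec (i : 'I_n) : 'rV[R]_n := delta_mx ord0 i.

Definition orthonormal_frame (B : 'I_n -> 'rV[R]_n -> 'rV[R]_n)
    (Omega : set 'rV[R]_n) :=
  forall x, Omega x -> forall i j, dot (B i x) (B j x) = (i == j)%:R.

(* Id - u u^T; the vectors are rows, so the (i, j) entry of u^T *m u is u_i u_j *)
Definition perp_proj u : 'M[R]_n := 1%:M - u^T *m u.

Definition C1_bounded_differential (f : 'rV[R]_n -> 'rV[R]_n) :=
  [/\ forall x, differentiable f x,
      continuous (jacobian f) &
      exists M : R, forall x, `|'J f x| <= M].

End euclidean.

Section domains.
Variables (R : realType).

Definition domain n (Omega : set 'rV[R]_n) :=
  [/\ open Omega, connected Omega & Omega !=set0].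

(* Near each of its boundary points, Omega is in some orthonormal coordinates
   the strict epigraph of a Lipschitz function of all coordinates but the last. *)
Definition lipschitz_boundary n (Omega : set 'rV[R]_n.+1) :=
  forall p, (closure Omega `\` interior Omega) p ->
  exists (r : R) (Q : 'M[R]_n.+1) (gamma : 'rV[R]_n -> R),
  [/\ 0 < r, Q *m Q^T = 1%:M, lipschitz gamma &
      forall x, ball p r x ->
        Omega x <-> gamma (col' ord_max (x *m Q)) < (x *m Q) ord0 ord_max].

End domains.

Section function_spaces.
Variables (R : realType) (n : nat) (Omega : set 'rV[R]_n).
Local Notation mu := (lebesgue_rV R n).
Implicit Types (phi psi v h : 'rV[R]_n -> R) (b g : 'rV[R]_n -> 'rV[R]_n).

Definition partial (i : 'I_n) (f : 'rV[R]_n -> R) : 'rV[R]_n -> R :=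
  fun x => 'D_(basis_vec R i) f x.

Definition smooth (f : 'rV[R]_n -> R) :=
  forall (s : seq 'I_n) x, differentiable (foldr partial f s) x.

(* C_c^infty(Omega), its elements being extended by 0 to R^n *)
Definition test_function phi :=
  [/\ smooth phi, compact (closure [set x | phi x != 0]) &
      closure [set x | phi x != 0] `<=` Omega].

Definition L2 v := v \_ Omega \in Lfun mu 2%:E.

Definition L2norm v : \bar R := 'N[mu]_(2%:E)[EFin \o (v \_ Omega)].

Definition L2vec g := forall i, L2 (fun x => g x ord0 i).

Definition L2vecnorm g : \bar R := L2norm (fun x => enorm (g x)).

Definition weak_partial (j : 'I_n) psi h :=
  forall phi, test_function phi ->
    \int[mu]_(x in Omega) (psi x * partial j phi x) =
    - \int[mu]_(x in Omega) (h x * phi x).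

(* r = <d_j v, psi> for v in L^2(Omega), the distribution d_j v in H^-1(Omega)
   being extended to the psi in H^1_0(Omega) *)
Definition partial_pairing (j : 'I_n) v psi (r : R) :=
  exists h, [/\ L2 h, weak_partial j psi h &
    r = - \int[mu]_(x in Omega) (v x * h x)].

(* g in L^2(Omega)^n is the distribution (Id - b b^T) grad v. For a Lipschitz
   function a, the distribution a d_j v is phi |-> <d_j v, a phi>, where a phi is
   Lipschitz with compact support, hence weakly differentiable. *)
Definition is_perp_grad b v g :=
  L2vec g /\
  forall (i : 'I_n) phi, test_function phi ->
    exists r : 'I_n -> R,
      (forall j, partial_pairing j v (fun x => perp_proj (b x) i j * phi x) (r j))
      /\ \int[mu]_(x in Omega) (g x ord0 i * phi x) = \sum_j r j.

Definition H1perp b v := L2 v /\ exists g, is_perp_grad b v g.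

(* graph norm of v, where g is the perpendicular gradient of v *)
Definition H1perp_norm v g : \bar R :=
  ((L2norm v ^+ 2 + L2vecnorm g ^+ 2) `^ 2^-1)%E.

(* closure of C_c^infty(Omega) in H1perp for the graph norm *)
Definition H1perp0 b v :=
  H1perp b v /\
  forall eps : R, 0 < eps ->
    exists phi g, [/\ test_function phi,
      is_perp_grad b (fun x => v x - phi x) g &
      (H1perp_norm (fun x => (v x - phi x)%R) g < eps%:E)%E].

End function_spaces.

(* Main.v *)
(* On Omega, b_n is a unit field orthogonal to b, so b_n . grad phi = b_n . grad_perp phi
   and it suffices to bound phi by its derivative along b_n. Take the weight
   h = exp (lambda w . x): the integral of div (h phi^2 b_n) vanishes, and since
   b_n . grad h = lambda h (b_n . w) >= lambda alpha h, for lambda large this term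
   dominates the bounded divergence of b_n, which gives
   int h phi^2 <= - 2 int h phi (b_n . grad phi) <= 1/2 int h phi^2 + 2 int h |grad_perp phi|^2.
   The weight is bounded above and below on the bounded set Omega; this is the
   inequality for test functions, and a density argument extends it. *)
Require Import Defs.
From mathcomp Require Import all_boot all_order all_algebra.
From mathcomp Require Import all_classical all_reals all_analysis.
From mathcomp Require Import measurable_realfun.
From mathcomp Require Import ring lra.

Import Order.TTheory GRing.Theory Num.Theory.
Import numFieldTopology.Exports numFieldNormedType.Exports.

Local Open Scope classical_set_scope.
Local Open Scope ring_scope.

Set Implicit Arguments.
Unset Strict Implicit.
Unset Printing Implicit Defensive.

(** * The Borel sigma-algebra of row vectors *)

(** The perpendicular gradient is known only through its action on test functions, and each pairing
    may use its own weak derivative, so neither linearity nor agreement with the classical formula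
    on test functions is immediate. For an approximation [phi] of [v], the difference [G] of the
    representatives for [v] and [v - phi] stands in for the perpendicular gradient of [phi], and is
    shown to act as the classical one on test functions.

    The energy estimate would have [G] tested with the components of h phi b_n, which are only C^1.
    Instead of regularizing them, the proof shows that [G] minus the classical perpendicular
    gradient, multiplied by [phi], vanishes almost everywhere. The factor [phi] loses nothing, since
    the integrand carries it, and it provides the compact support: the test functions are f phi,
    with f in an algebra of explicit smooth functions, so no bump function has to be built. The
    divergence formula rests on Fubini and the one-dimensional fundamental theorem, on the whole
    space, where b_n is defined and [phi] vanishes off [Omega]. *)

Lemma ler_coord_norm (R : realType) (n : nat) (x : 'rV[R]_n) (i : 'I_n) :
  `|x ord0 i| <= `|x|.
Proof.
by rewrite {2}/Num.norm/= mx_normrE; apply: (le_bigmax _ (fun p => `|x p.1 p.2|) (ord0, i)).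
Qed.

Lemma norm_rV_le (R : realType) (n : nat) (x : 'rV[R]_n) (r : R) :
  0 <= r -> (forall i, `|x ord0 i| <= r) -> `|x| <= r.
Proof.
move=> r0 xr; rewrite /Num.norm/= mx_normrE; apply/bigmax_leP; split => //.
by case=> i j _ /=; rewrite (ord1 i).
Qed.

(** The sigma-algebra is defined by the coordinates, so openness enters through second countability:
    an open set is the union of the countably many rational boxes that it contains. *)
Lemma measurable_open_rV (R : realType) (n : nat) (A : set 'rV[R]_n) :
  open A -> measurable A.
Proof.
move=> oA.
pose box (p : 'rV[rat]_n * 'rV[rat]_n) := [set x : 'rV[R]_n | forall i,
  `]ratr (p.1 ord0 i), ratr (p.2 ord0 i)[%classic (rV_coord i x)].
pose F (p : 'rV[rat]_n * 'rV[rat]_n) := if `[< box p `<=` A >] then box p else set0.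
rewrite (_ : A = \bigcup_p F p).
  apply: countable_bigcupT_measurable; first exact: countableP.
  move=> p; rewrite /F; case: ifP => // _.
  apply: (@measurable_rV_box R n (fun i => `]ratr (p.1 ord0 i), ratr (p.2 ord0 i)[%classic)).
  by move=> i; exact: measurable_itv.
apply/seteqP; split => [x Ax|x [p _]]; last first.
  by rewrite /F; case: ifPn => // /asboolP; apply.
have /nbhs_ballP[e e0 xeA] : nbhs x A by exact: open_nbhs_nbhs.
(* Balls are those of the sup norm, so a box whose corners stay within [e] of [x] in each coordinate
   lies in the ball. *)
have rq i : exists q : rat, ratr q \in `]x ord0 i - e, x ord0 i[.
  by apply: rat_in_itvoo; rewrite ltrBlDr ltrDl.
have rs i : exists q : rat, ratr q \in `]x ord0 i, x ord0 i + e[.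
  by apply: rat_in_itvoo; rewrite ltrDl.
have [q qP] := choice rq; have [s sP] := choice rs.
exists (\row_i q i, \row_i s i) => //; rewrite /F ifT.
  move=> i /=; rewrite /rV_coord !mxE in_itv/=.
  by have /[!in_itv]/= /andP[_ ->] := qP i; have /[!in_itv]/= /andP[-> _] := sP i.
apply/asboolP => y xy; apply: xeA; split => // i j; rewrite (ord1 i).
have := xy j; rewrite /= /rV_coord !mxE in_itv/= => /andP[qy ys].
have /[!in_itv]/= /andP[q1 q2] := qP j; have /[!in_itv]/= /andP[s1 s2] := sP j.
rewrite /ball/= ltr_distlC; apply/andP; split.
  exact: lt_trans q1 qy.
exact: lt_trans ys s2.
Qed.

Lemma measurable_cont_rV (R : realType) (n : nat) (D : set 'rV[R]_n)
    (f : 'rV[R]_n -> R) :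
  open D -> (forall x, D x -> {for x, continuous f}) -> measurable_fun D f.
Proof.
move=> oD cf; apply: (measurability _ (measurable_realfun.RGenOpens.measurableE R)).
move=> _ [_ [a [b ->] <-]]; apply: measurable_open_rV.
rewrite openE => x [Dx fx]; apply: filterI; first exact: open_nbhs_nbhs.
by apply: (cf x Dx); apply: open_nbhs_nbhs; split => //; exact: interval_open.
Qed.

Lemma measurable_cont_rVT (R : realType) (n : nat) (f : 'rV[R]_n -> R) :
  continuous f -> measurable_fun setT f.
Proof. by move=> cf; apply: measurable_cont_rV => [|x _]; [exact: openT|exact: cf]. Qed.

Lemma lebesgue_rV_bounded (R : realType) (n : nat) (A : set 'rV[R]_n) :
  measurable A -> bounded_set A -> (lebesgue_rV R n A < +oo)%E.
Proof.
move=> mA [M [Mr AM]].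
(* [bounded_set] gives the bound for every number strictly above [M]; this one is moreover positive.
   The same choice recurs below. *)
pose K := `|M| + 1.
have mb : forall i : 'I_n, measurable ((fun=> `[-K, K]%classic : set (measurableTypeR R)) i).
  by move=> i; exact: measurable_itv.
apply: (@le_lt_trans _ _ (lebesgue_rV R n
   [set x | forall i : 'I_n, `[-K, K]%classic (rV_coord i x)])).
  apply: le_measure; rewrite ?inE//; first exact: (measurable_rV_box mb).
  move=> x Ax i /=; rewrite in_itv/= -ler_norml.
  apply: le_trans (ler_coord_norm _ _) _; apply: AM Ax.
  by rewrite (le_lt_trans (ler_norm M))// ltrDl.
rewrite (lebesgue_rV_box mb).
elim/big_rec : _ => [|i x _ xoo]; first by rewrite ltry.
rewrite lebesgue_measure_itv/=; case: ifP => _; last by rewrite mul0e.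
rewrite -EFinB; rewrite lte_mul_pinfty//.
by rewrite lee_fin opprK addr_ge0// addr_ge0.
Qed.

(** * The integral of a partial derivative *)

Lemma closed_norm_le (R : realType) (n : nat) (K : R) :
  closed [set x : 'rV[R]_n | `|x| <= K].
Proof.
apply: (@preimage_closed _ _ (fun x : 'rV[R]_n => `|x|) [set t | t <= K]).
  by move=> x _; exact: norm_continuous.
exact: (@closed_le R).
Qed.

Lemma bounded_norm_le (R : realType) (n : nat) (K : R) :
  bounded_set [set x : 'rV[R]_n | `|x| <= K].
Proof.
exists K; split; first exact: num_real.
by move=> M KM x /= /le_trans; apply; exact: ltW.
Qed.

Lemma continuous_bounded_on (R : realType) (n : nat) (f : 'rV[R]_n -> R) (A : set 'rV[R]_n) :
  continuous f -> bounded_set A -> exists C, forall x, A x -> `|f x| <= C.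
Proof.
move=> cf [M [_ AM]]; pose K := `|M| + 1.
have MK : M < K by rewrite (le_lt_trans (ler_norm M))// ltrDl.
have cA : compact [set x : 'rV[R]_n | `|x| <= K].
  by apply: bounded_closed_compact; [exact: bounded_norm_le|exact: closed_norm_le].
have /compact_bounded[N [_ AN]] : compact (f @` [set x : 'rV[R]_n | `|x| <= K]).
  by apply: continuous_compact => //; exact: continuous_subspaceT.
exists (`|N| + 1) => x Ax.
apply: (AN (`|N| + 1)); first by rewrite (le_lt_trans (ler_norm N))// ltrDl.
by exists x => //=; exact: AM MK _ Ax.
Qed.

Lemma bounded_integrable (R : realType) d (T : measurableType d)
    (mu : {measure set T -> \bar R}) (D : set T) (f : T -> R) (C : R) :
  measurable D -> (mu D < +oo)%E -> measurable_fun D f ->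
  (forall x, D x -> `|f x| <= C) -> mu.-integrable D (EFin \o f).
Proof.
move=> mD Doo mf fC; apply: measurable_bounded_integrable => //.
exists C; split; first exact: num_real.
by move=> M CM x Dx; apply: le_trans (fC x Dx) (ltW CM).
Qed.

Lemma vanish_integrable (R : realType) (n : nat) (f : 'rV[R]_n -> R) (K : R) :
  continuous f -> (forall x, K < `|x| -> f x = 0) ->
  (lebesgue_rV R n).-integrable setT (EFin \o f).
Proof.
move=> cf f0; have [C fC] := continuous_bounded_on cf (bounded_norm_le n K).
pose A := [set x : 'rV[R]_n | `|x| <= K].
have mA : measurable A.
  rewrite -[A]setCK; apply: measurableC; apply: measurable_open_rV.
  by apply: closed_openC; exact: closed_norm_le.
have -> : EFin \o f = (EFin \o f) \_ A.
  apply/funext => x; rewrite patchE; case: ifPn => //.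
  by rewrite notin_setE => /negP; rewrite -ltNge => /f0 /= ->.
apply/(integrable_restrict _ mA measurableT); rewrite setTI.
apply: (@bounded_integrable _ _ _ _ _ _ C) => //.
- by apply: lebesgue_rV_bounded => //; exact: bounded_norm_le.
- by apply: measurable_funTS; exact: measurable_cont_rVT.
Qed.

(** A directional derivative sees only the restriction to a line. This principle moves derivatives
    between one and several variables when coordinates are frozen or split off. *)
Lemma is_derive_transport (R : realType) (V V' : normedModType R)
    (f : V -> R) (g : V' -> R) (x v : V) (y w : V') (d : R) :
  (forall h : R, f (h *: v + x) = g (h *: w + y)) ->
  is_derive x v f d -> is_derive y w g d.
Proof.
move=> fg [df <-].
have E : (fun h : R => h^-1 *: ((f \o shift x) (h *: v) - f x)) =
         (fun h : R => h^-1 *: ((g \o shift y) (h *: w) - g y)).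
  apply/funext => h /=; rewrite fg.
  by have := fg 0; rewrite !scale0r !add0r => ->.
by split; rewrite /derivable /derive -E.
Qed.

(** * Slices along the first coordinate *)

Section rV_cons.
Context (R : realType) (n : nat).
Local Notation cons := (@rV_cons R n).

Lemma rV_cons0 a v : cons (a, v) ord0 ord0 = a.
Proof. by have /(congr1 fst) := @rV_consK R n (a, v). Qed.

Lemma rV_consS a v j : cons (a, v) ord0 (lift ord0 j) = v ord0 j.
Proof.
rewrite /rV_cons (_ : lift ord0 j = rshift 1 j); last exact/val_inj.
exact: row_mxEr.
Qed.

Lemma scale_basis_vecE m (h : R) (i k : 'I_m) :
  (h *: basis_vec R i) ord0 k = h * (k == i)%:R.
Proof. by rewrite !mxE eqxx. Qed.

Lemma rV_cons_shift0 (h a : R) v :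
  cons (h *: 1 + a, v) = h *: basis_vec R ord0 + cons (a, v).
Proof.
apply/rowP => k; rewrite [RHS]mxE scale_basis_vecE.
case: (unliftP ord0 k) => [j|] ->; first by rewrite !rV_consS mulr0 add0r.
by rewrite !rV_cons0 eqxx.
Qed.

Lemma rV_cons_shiftS (h a : R) v j :
  cons (a, h *: basis_vec R j + v) = h *: basis_vec R (lift ord0 j) + cons (a, v).
Proof.
apply/rowP => k; rewrite [RHS]mxE scale_basis_vecE.
case: (unliftP ord0 k) => [l|] ->; last by rewrite !rV_cons0 mulr0 add0r.
by rewrite !rV_consS [LHS]mxE scale_basis_vecE (inj_eq lift_inj).
Qed.

Lemma norm_rV_cons1 (a : R) v : `|a| <= `|cons (a, v)|.
Proof. by rewrite -{1}(rV_cons0 a v) ler_coord_norm. Qed.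

Lemma norm_rV_cons2 (a : R) v : `|v| <= `|cons (a, v)|.
Proof.
by apply: norm_rV_le => // i; rewrite -(rV_consS a); exact: ler_coord_norm.
Qed.

Lemma rV_cons_continuous1 v : continuous (fun a : R => cons (a, v)).
Proof.
move=> a U /nbhs_ballP[e e0 eU]; apply/nbhs_ballP; exists e => //= b ab; apply: eU.
split => // i j; rewrite (ord1 i); case: (unliftP ord0 j) => [l|] ->.
  by rewrite !rV_consS; exact: ballxx.
by rewrite !rV_cons0.
Qed.

Lemma rV_cons_continuous2 (a : R) : continuous (fun v => cons (a, v)).
Proof.
move=> v U /nbhs_ballP[e e0 eU]; apply/nbhs_ballP; exists e => //= b [_ vb]; apply: eU.
split => // i j; rewrite (ord1 i); case: (unliftP ord0 j) => [l|] ->.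
  by rewrite !rV_consS; exact: vb.
by rewrite !rV_cons0; exact: ballxx.
Qed.

Lemma integrable_rV_cons (f : 'rV[R]_n.+1 -> R) :
  (lebesgue_rV R n.+1).-integrable setT (EFin \o f) ->
  (@lebesgue_measure R \x lebesgue_rV R n)%E.-integrable setT
    (fun p => (f (cons p))%:E).
Proof.
move=> /integrableP[mf foo]; apply/integrableP; split.
  exact: (measurableT_comp mf (@measurable_rV_cons R n)).
move: foo; rewrite /= (ge0_integral_pushforward (@measurable_rV_cons R n))//.
by apply/measurable_EFinP; apply: measurableT_comp => //; exact/measurable_EFinP.
Qed.

Lemma integral_rV_cons (f : 'rV[R]_n.+1 -> R) :
  (lebesgue_rV R n.+1).-integrable setT (EFin \o f) ->
  (\int[lebesgue_rV R n.+1]_x (f x)%:E =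
   \int[@lebesgue_measure R \x lebesgue_rV R n]_p (f (cons p))%:E)%E.
Proof.
move=> fi; have := integrable_rV_cons fi; move/integrableP : fi => [mf _] fi.
rewrite (@integral_pushforward _ _ _ _ _ _ (@measurable_rV_cons R n) _ setT (EFin \o f))//.
Qed.

End rV_cons.

Lemma integral_derive1_vanish (R : realType) (F f : R -> R) (K : R) :
  (forall x : R, is_derive x (1 : R) F (f x)) -> continuous f ->
  (forall x, K < `|x| -> F x = 0) -> (forall x, K < `|x| -> f x = 0) ->
  (\int[@lebesgue_measure R]_x (f x)%:E = 0)%E.
Proof.
move=> dF cf F0 f0; pose L : R := `|K| + 1.
have KL : K < L by rewrite (le_lt_trans (ler_norm K))// ltrDl.
have L0 : 0 < L by rewrite ltr_wpDl.
have cF : continuous F.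
  by move=> x; apply: differentiable_continuous; apply/derivable1_diffP; exact: ex_derive.
transitivity (\int[@lebesgue_measure R]_(x in `[(- L)%R, L]%classic) (f x)%:E)%E.
  rewrite [RHS]integral_mkcond; apply: eq_integral => x _; rewrite patchE.
  case: ifPn => //; rewrite notin_setE /= in_itv/= -ler_norml => /negP; rewrite -ltNge => Lx.
  by rewrite f0// (lt_trans KL).
rewrite (@continuous_FTC2 _ f F)//.
- by rewrite !F0 ?subee// ?normrN gtr0_norm.
- by rewrite ltrNl (lt_trans _ L0)// oppr_lt0.
- exact: continuous_subspaceT.
- split; first by move=> x _; exact: ex_derive.
  + by apply: cvg_at_right_filter; exact: cF.
  + by apply: cvg_at_left_filter; exact: cF.
- by move=> x _; rewrite derive1E; exact: derive_val.
Qed.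

(** Fubini, by induction on the dimension: along the first coordinate the inner integral vanishes by
    the one-variable case; otherwise that coordinate is frozen and the induction hypothesis applies
    to the slice. Support is expressed by a norm bound because this passes to slices, the sup norm
    of the remaining coordinates being no larger. *)
Lemma integral_partial_vanish (R : realType) (n : nat) (i : 'I_n)
    (F f : 'rV[R]_n -> R) (K : R) :
  (forall x, is_derive x (basis_vec R i) F (f x)) -> continuous f ->
  (forall x, K < `|x| -> F x = 0) -> (forall x, K < `|x| -> f x = 0) ->
  (\int[lebesgue_rV R n]_x (f x)%:E = 0)%E.
Proof.
elim: n i F f => [[]//|n IH] i F f dF cf F0 f0.
have fi := vanish_integrable cf f0.
have fci := integrable_rV_cons fi.
rewrite (integral_rV_cons fi); case: (unliftP ord0 i) => [j ij|i0].
  rewrite -integral12_prod_meas1//; apply: integral0_eq => a _.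
  rewrite /fubini_F; apply: (IH j (fun v => F (rV_cons (a, v)))).
  - move=> v; apply: is_derive_transport (dF (rV_cons (a, v))) => h.
    by rewrite rV_cons_shiftS ij.
  - by move=> v; apply: continuous_comp; [exact: rV_cons_continuous2|exact: cf].
  - by move=> v Kv; rewrite F0// (lt_le_trans Kv)// norm_rV_cons2.
  - by move=> v Kv; rewrite f0// (lt_le_trans Kv)// norm_rV_cons2.
rewrite -integral21_prod_meas1//; apply: integral0_eq => v _.
rewrite /fubini_G; apply: (@integral_derive1_vanish _ (fun a => F (rV_cons (a, v))) _ K).
- move=> a; apply: is_derive_transport (dF (rV_cons (a, v))) => h.
  by rewrite rV_cons_shift0 i0.
- by move=> a; apply: continuous_comp; [exact: rV_cons_continuous1|exact: cf].
- by move=> a Ka; rewrite F0// (lt_le_trans Ka)// norm_rV_cons1.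
- by move=> a Ka; rewrite f0// (lt_le_trans Ka)// norm_rV_cons1.
Qed.

(** * Smooth functions *)

Section smooth_algebra.
Context (R : realType) (n : nat).
Implicit Types f g phi : 'rV[R]_n -> R.

Lemma differentiable_coord_rV (i : 'I_n) x :
  differentiable (fun y : 'rV[R]_n => y ord0 i) x.
Proof. exact: differentiable_coord. Qed.

Lemma diff_is_derive f x v : differentiable f x -> is_derive x v f ('D_v f x).
Proof. by move=> df; apply: DeriveDef => //; exact: diff_derivable. Qed.

Lemma coord_comp_is_derive (g : R -> R) (d : R) (i j : 'I_n) (x : 'rV[R]_n) :
  is_derive (x ord0 i) (1 : R) g d ->
  is_derive x (basis_vec R j) (fun y => g (y ord0 i)) (d * (i == j)%:R).
Proof.
move=> gd; case: (eqVneq i j) => [<-|ij].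
  rewrite mulr1; apply: is_derive_transport gd => h.
  by rewrite [(_ + x) _ _]mxE scale_basis_vecE eqxx.
rewrite mulr0; apply: is_derive_transport (is_derive_cst (g (x ord0 i)) x 0) => h.
by rewrite [(_ + x) _ _]mxE scale_basis_vecE (negbTE ij) mulr0 add0r.
Qed.

Lemma coord_comp_differentiable (g : R -> R) (i : 'I_n) (x : 'rV[R]_n) :
  derivable g (x ord0 i) 1 -> differentiable (fun y : 'rV[R]_n => g (y ord0 i)) x.
Proof.
move=> /derivable1_diffP dg.
exact: (differentiable_comp (differentiable_coord_rV i x) dg).
Qed.

(* Closed under partial derivatives, so that smoothness of its members follows by
   induction; the Gompertz functions yield smooth approximations of half-lines. *)
Inductive smooth_algebra : ('rV[R]_n -> R) -> Prop :=
| smooth_algebra_smooth f : smooth f -> smooth_algebra f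
| smooth_algebra_cst c : smooth_algebra (fun=> c)
| smooth_algebra_expR c k i : smooth_algebra (fun x => expR (c + k * x ord0 i))
| smooth_algebra_gompertz c k i :
    smooth_algebra (fun x => expR (- expR (c + k * x ord0 i)))
| smooth_algebraD f g : smooth_algebra f -> smooth_algebra g ->
    smooth_algebra (fun x => f x + g x)
| smooth_algebraM f g : smooth_algebra f -> smooth_algebra g ->
    smooth_algebra (fun x => f x * g x).

Lemma is_derive_expR_affine (c k t : R) :
  is_derive t (1 : R) (fun t => expR (c + k * t)) (k * expR (c + k * t)).
Proof.
have H : is_derive t (1 : R) (fun t => c + k * t) k.
  rewrite (_ : (fun _ => _) = cst c + k *: id :> (R -> R))//.
  by apply: is_derive_eq; rewrite add0r [LHS]mulr1.
have := @is_derive1_comp _ expR (fun t => c + k * t) t _ _ (is_derive_expR _) H.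
by rewrite mulrC.
Qed.

Lemma is_derive_gompertz (c k t : R) :
  is_derive t (1 : R) (fun t => expR (- expR (c + k * t)))
    (- k * (expR (c + k * t) * expR (- expR (c + k * t)))).
Proof.
have H : is_derive t (1 : R) (fun t => - expR (c + k * t)) (- (k * expR (c + k * t))).
  exact: (is_deriveN (is_derive_expR_affine c k t)).
have := @is_derive1_comp _ expR _ t _ _ (is_derive_expR _) H.
by rewrite mulrC !mulNr mulrA.
Qed.

(** Differentiating a Gompertz generator brings out an exponential factor, and exponentials
    reproduce themselves; this is why both families are generators. *)
Lemma smooth_algebra_partial f : smooth_algebra f ->
  (forall x, differentiable f x) /\ (forall j, smooth_algebra (partial j f)).
Proof.
elim => {f} [f sf|c|c k i|c k i|f g _ [df sf] _ [dg sg]|f g af [df sf] ag [dg sg]].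
- split=> [x|j]; first exact: (sf [::] x).
  apply: smooth_algebra_smooth => s x.
  by have := sf (rcons s j) x; rewrite foldr_rcons.
- split=> [x|j]; first exact: differentiable_cst.
  rewrite (_ : partial j _ = fun=> 0); first exact: smooth_algebra_cst.
  by apply/funext => x; rewrite /partial derive_cst.
- split=> [x|j].
    apply: (@coord_comp_differentiable (fun t => expR (c + k * t))).
    by have [] := is_derive_expR_affine c k (x ord0 i).
  rewrite (_ : partial j _ = fun x => (k * (i == j)%:R) * expR (c + k * x ord0 i)).
    by apply: smooth_algebraM; [exact: smooth_algebra_cst|exact: smooth_algebra_expR].
  apply/funext => x; rewrite /partial.
  have := @coord_comp_is_derive (fun t => expR (c + k * t)) _ i j x (is_derive_expR_affine _ _ _).
  by case=> _ ->; rewrite mulrAC.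
- split=> [x|j].
    apply: (@coord_comp_differentiable (fun t => expR (- expR (c + k * t)))).
    by have [] := is_derive_gompertz c k (x ord0 i).
  rewrite (_ : partial j _ = fun x => (- k * (i == j)%:R) *
      (expR (c + k * x ord0 i) * expR (- expR (c + k * x ord0 i)))).
    apply: smooth_algebraM; first exact: smooth_algebra_cst.
    by apply: smooth_algebraM; [exact: smooth_algebra_expR|exact: smooth_algebra_gompertz].
  apply/funext => x; rewrite /partial.
  have := @coord_comp_is_derive (fun t => expR (- expR (c + k * t))) _ i j x (is_derive_gompertz _ _ _).
  by case=> _ ->; rewrite mulrAC.
- split=> [x|j]; first exact: differentiableD.
  rewrite (_ : partial j _ = fun x => partial j f x + partial j g x).
    exact: smooth_algebraD.
  by apply/funext => x; apply: deriveD; exact: diff_derivable.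
- split=> [x|j]; first exact: differentiableM.
  rewrite (_ : partial j _ = fun x => f x * partial j g x + g x * partial j f x).
    by apply: smooth_algebraD; exact: smooth_algebraM.
  by apply/funext => x; apply: deriveM; exact: diff_derivable.
Qed.

Lemma smooth_algebraW f : smooth_algebra f -> smooth f.
Proof.
move=> af s x; have : smooth_algebra (foldr (@partial R n) f s).
  by elim: s => //= j s /smooth_algebra_partial[].
by move=> /smooth_algebra_partial[].
Qed.

Lemma smooth_differentiable f : smooth f -> forall x, differentiable f x.
Proof. by move=> sf x; exact: (sf [::]). Qed.

Lemma smooth_partial f i : smooth f -> smooth (partial i f).
Proof. by move=> sf s x; have := sf (rcons s i) x; rewrite foldr_rcons. Qed.

Lemma smooth_continuous f : smooth f -> continuous f.
Proof. by move=> sf x; apply: differentiable_continuous; exact: smooth_differentiable. Qed.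

(* The inner exponent m - m^2 t is such that the limit at t = 0 is 0. *)
Definition smooth_step (m : nat) (t : R) : R := expR (- expR (m%:R - m%:R ^+ 2 * t)).

Lemma smooth_step_bound m t : 0 <= smooth_step m t <= 1.
Proof. by rewrite expR_ge0 -[leRHS]expR0 ler_expR oppr_le0 expR_ge0. Qed.

Lemma smooth_algebra_step m i a : smooth_algebra (fun x => smooth_step m (x ord0 i - a)).
Proof.
rewrite (_ : (fun _ => _) = (fun x : 'rV[R]_n =>
    expR (- expR ((m%:R + m%:R ^+ 2 * a) + (- m%:R ^+ 2) * x ord0 i)))).
  exact: smooth_algebra_gompertz.
by apply/funext => x; rewrite /smooth_step; congr (expR (- expR _)); ring.
Qed.

Lemma cvg_smooth_step t : smooth_step m t @[m --> \oo] --> ((0 < t)%R%:R : R).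
Proof.
have h0 : harmonic m @[m --> \oo] --> (0 : R) by exact: cvg_harmonic.
case: ltP => t0 /=.
  apply: (@squeeze_cvgr _ _ _ _ (fun m => 1 - harmonic m) (fun=> 1)).
  - near=> m; rewrite (andP (smooth_step_bound m t)).2 andbT.
    apply: le_trans (expR_ge1Dx _); rewrite lerD2l lerN2 /harmonic.
    rewrite -[leLHS]invrK lef_pV2 ?posrE ?invr_gt0 ?expR_gt0// -expRN.
    apply: le_trans (expR_ge1Dx _); rewrite -[_.+1%:R]natr1 addrC lerD2l opprB expr2.
    (* From [m >= 2 / t] on, [m^2 t - m >= m], so the inner exponential is at most [1 / (m + 1)]. *)
    have : (2 / t) <= m%:R by near: m; exact: nbhs_infty_ger.
    by rewrite ler_pdivrMr// => tm; have : 0 <= m%:R :> R by []; nra.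
  - by rewrite -[X in _ --> X]subr0; apply: cvgB => //; exact: cvg_cst.
  - exact: cvg_cst.
(* For [t <= 0] the inner exponent is at least [m], and [e^x >= 1 + x] used twice gives the bound
   [1 / (m + 1)]. *)
apply: (@squeeze_cvgr _ _ _ _ (fun=> 0) (@harmonic R)) => //; last exact: cvg_cst.
near=> m; rewrite (andP (smooth_step_bound m t)).1 /= /smooth_step expRN /harmonic.
rewrite lef_pV2 ?posrE ?expR_gt0//; apply: le_trans (expR_ge1Dx _).
rewrite -[_.+1%:R]natr1 addrC lerD2l.
apply: (@le_trans _ _ (1 + (m%:R - m%:R ^+ 2 * t))); last exact: expR_ge1Dx.
have : 0 <= m%:R ^+ 2 :> R by exact: sqr_ge0.
by nra.
Unshelve. all: by end_near. Qed.

End smooth_algebra.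

(** * The fundamental lemma of the calculus of variations *)

Section fundamental_lemma.
Context (R : realType) (n : nat).

(** With a list of constraints, intersection is concatenation and the empty list gives the whole
    space. The inequalities are strict because the smooth steps tend to 0 at 0. *)
Definition orthant (s : seq ('I_n * R)) : set 'rV[R]_n :=
  [set x | all (fun p => p.2 < x ord0 p.1) s].

Definition smooth_orthant (s : seq ('I_n * R)) (m : nat) (x : 'rV[R]_n) : R :=
  \prod_(p <- s) smooth_step m (x ord0 p.1 - p.2).

Lemma smooth_algebra_orthant s m : smooth_algebra (smooth_orthant s m).
Proof.
rewrite /smooth_orthant; elim: s => [|p s IH].
  rewrite (_ : (fun _ => _) = fun=> 1); first exact: smooth_algebra_cst.
  by apply/funext => x; rewrite big_nil.
rewrite (_ : (fun _ => _) = fun x : 'rV[R]_n => smooth_step m (x ord0 p.1 - p.2) *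
    \prod_(p <- s) smooth_step m (x ord0 p.1 - p.2)).
  by apply: smooth_algebraM => //; exact: smooth_algebra_step.
by apply/funext => x; rewrite big_cons.
Qed.

Lemma smooth_orthant_bound s m x : 0 <= smooth_orthant s m x <= 1.
Proof.
rewrite /smooth_orthant; elim/big_rec : _ => [|p y _ /andP[y0 y1]]; first by rewrite ler01 lexx.
have /andP[s0 s1] := smooth_step_bound m (x ord0 p.1 - p.2).
by rewrite mulr_ge0// mulr_ile1.
Qed.

Lemma cvg_smooth_orthant s x :
  smooth_orthant s m x @[m --> \oo] --> (\1_(orthant s) x : R).
Proof.
rewrite indicE /smooth_orthant; elim: s => [|p s IH].
  rewrite mem_set//.
  under eq_fun do rewrite big_nil.
  exact: cvg_cst.
under eq_fun do rewrite big_cons.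
rewrite (_ : (x \in orthant (p :: s))%:R = (0 < x ord0 p.1 - p.2)%R%:R * (x \in orthant s)%:R :> R).
  by apply: cvgM => //; exact: cvg_smooth_step.
rewrite -natrM mulnb subr_gt0; congr (_ %:R); congr nat_of_bool.
by apply/idP/idP => [|/andP[ps /set_mem s0]]; [rewrite inE => /andP[-> ?] /=; exact: mem_set|
  apply/mem_set; rewrite /orthant/= ps].
Qed.

Lemma measurable_orthant s : measurable (orthant s).
Proof.
elim: s => [|p s IH].
  by rewrite (_ : orthant _ = setT)//; apply/seteqP; split.
rewrite (_ : orthant _ = rV_coord p.1 @^-1` `]p.2, +oo[%classic `&` orthant s).
  apply: measurableI => //; rewrite -[X in measurable X]setTI.
  by apply: measurable_rV_coord => //; exact: measurable_itv.
by apply/seteqP; split => x /=; rewrite in_itv/= andbT => /andP.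
Qed.

Lemma orthant_setI_closed : setI_closed (range orthant).
Proof.
move=> _ _ [s _ <-] [t _ <-]; exists (s ++ t) => //.
by apply/seteqP; split => x; rewrite /orthant/= all_cat => /andP.
Qed.

Lemma measurable_rV_orthant :
  @measurable _ 'rV[R]_n = <<s range orthant >>.
Proof.
apply/seteqP; split; last first.
  apply: smallest_sub; first exact: sigma_algebra_measurable.
  by move=> _ [s _ <-]; exact: measurable_orthant.
apply: smallest_sub; first exact: smallest_sigma_algebra.
rewrite -bigcup_seq; apply: bigcup_sub => i _ _ [B mB <-].
pose T := g_sigma_algebraType (range orthant).
suff mf : measurable_fun [set: T] (@rV_coord R n i : T -> measurableTypeR R) by exact: mf.
apply: (measurability _ (RGenOInfty.measurableE R)) => _ [_ [a ->] <-].
apply: sub_sigma_algebra; exists [:: (i, a)] => //.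
apply/seteqP; split => x; rewrite /orthant/= /rV_coord in_itv/= !andbT; last by case.
by [].
Qed.

Variables (mu : {measure set 'rV[R]_n -> \bar R}) (D : set 'rV[R]_n) (X : 'rV[R]_n -> R).
Hypotheses (mD : measurable D) (iX : mu.-integrable D (EFin \o X)).
Hypothesis X0 : forall f, smooth_algebra f -> (forall x, 0 <= f x <= 1) ->
  \int[mu]_(x in D) (f x * X x) = 0.

Lemma smooth_algebra_measurable f : smooth_algebra f -> measurable_fun [set: 'rV[R]_n] f.
Proof.
by move=> /smooth_algebraW /smooth_continuous; exact: measurable_cont_rVT.
Qed.

(* Products of smooth steps tend everywhere to the indicators of the orthants,
   which form a generating pi-system. *)
Lemma integral_orthant0 s : (\int[mu]_(x in D `&` orthant s) (X x)%:E = 0)%E.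
Proof.
have mX : measurable_fun D X by apply/measurable_EFinP; exact: (measurable_int mu).
have mf m : measurable_fun D (fun x => smooth_orthant s m x * X x).
  apply: measurable_funM => //; apply: measurable_funTS.
  by apply: smooth_algebra_measurable; exact: smooth_algebra_orthant.
rewrite integral_mkcondr.
have -> : (EFin \o X) \_ (orthant s) = (fun x => (\1_(orthant s) x * X x)%:E).
  apply/funext => x; rewrite patchE indicE; case: (x \in _) => /=.
    by rewrite mul1r.
  by rewrite mul0r.
have lef m x : D x -> (`|(smooth_orthant s m x * X x)%:E| <= `|(X x)%:E|)%E.
  move=> Dx; rewrite lee_fin normrM ler_piMl//.
  by have /andP[a0 a1] := smooth_orthant_bound s m x; rewrite ger0_norm.
have mI : measurable_fun D (fun x => \1_(orthant s) x * X x).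
  apply: measurable_funM => //; apply: measurable_funTS; apply: measurable_indic.
  exact: measurable_orthant.
have [] := @dominated_convergence _ _ _ mu D mD
  (fun m x => (smooth_orthant s m x * X x)%:E) (fun x => (\1_(orthant s) x * X x)%:E)
  (abse \o (EFin \o X)).
- by move=> m; exact/measurable_EFinP.
- exact/measurable_EFinP.
- apply: aeW => x Dx; apply: cvg_EFin; first by near=> m.
  by apply: cvgMl; exact: cvg_smooth_orthant.
- exact: integrable_abse.
- by apply: aeW => x m Dx; exact: lef.
move=> _ _ /cvg_lim <-//; apply: lim_near_cst => //; near=> m => /=.
(* [X0] concerns the real-valued integral, which is 0 also when the extended one is infinite;
   finiteness has to be checked before it can be used. *)
rewrite -[LHS]fineK; last first.
  apply: integrable_fin_num => //; apply: (le_integrable mD _ _ iX).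
    exact/measurable_EFinP.
  by move=> x Dx; exact: lef.
congr EFin; apply: X0; first exact: smooth_algebra_orthant.
by move=> x; exact: smooth_orthant_bound.
Unshelve. all: by end_near. Qed.

(** The sets on which [X] has integral zero form a Dynkin system containing the orthants, hence
    exhaust the measurable sets; this forces [X] to vanish almost everywhere. *)
Lemma ae_eq0_smooth_algebra : ae_eq mu D (EFin \o X) (cst 0%E).
Proof.
have mX : measurable_fun D (EFin \o X) by exact: (measurable_int mu).
have H A : measurable A -> (\int[mu]_(x in D `&` A) (X x)%:E = 0)%E.
  rewrite measurable_rV_orthant.
  apply: (dynkin_induction (P := fun A => (\int[mu]_(x in D `&` A) (X x)%:E = 0)%E)
    measurable_rV_orthant orthant_setI_closed).
  - have := integral_orthant0 [::]; rewrite (_ : orthant [::] = setT)//.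
    by apply/seteqP; split.
  - by move=> _ [s _ <-]; exact: integral_orthant0.
  - move=> S mS S0.
    have : (\int[mu]_(x in D) (X x)%:E = 0)%E.
      rewrite -[D]setIT (_ : setT = orthant [::]); first exact: integral_orthant0.
      by apply/seteqP; split.
    rewrite -{1}(setUIDK D S) integral_setU//=.
    + by rewrite S0 add0e setDE.
    + exact: measurableI.
    + exact: measurableD.
    + by rewrite setUIDK.
    + by rewrite disj_set2E; apply/eqP; rewrite setDE setIACA setICr setI0.
  - move=> F mF tF F0; rewrite setI_bigcupr integral_bigcup.
    + by apply: eseries0 => k _ _; exact: F0.
    + exact: trivIset_setIl.
    + by move=> k; exact: measurableI.
    + rewrite -setI_bigcupr; apply: integrableS iX => //.
      by apply: measurableI => //; exact: bigcup_measurable.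
apply: integral_ae_eq => //; move=> E ED mE; rewrite integral0.
by have := H E mE; rewrite setIidr.
Qed.

End fundamental_lemma.

(** * Square-integrable functions *)

Section L2_theory.
Context (R : realType) (n : nat) (Omega : set 'rV[R]_n).
Hypothesis mO : measurable Omega.
Local Notation mu := (lebesgue_rV R n).
Implicit Types u v phi psi h : 'rV[R]_n -> R.

Lemma L2norm_integral v :
  (L2norm Omega v = (\int[mu]_(x in Omega) (v x ^+ 2)%:E) `^ 2^-1)%E.
Proof.
rewrite /L2norm unlock /=; congr (_ `^ _)%E.
rewrite [RHS]integral_mkcond; apply: eq_integral => x _.
rewrite /= !patchE; case: ifPn => _; last by rewrite normr0 powR0.
by rewrite powR_mulrn// real_normK// num_real.
Qed.

Lemma L2_measurable v : L2 Omega v -> measurable_fun Omega v.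
Proof. by rewrite /L2 inE => /andP[]; rewrite inE/= => /(measurable_restrictT _ mO). Qed.

Lemma L2_integrable_sqr v : L2 Omega v -> mu.-integrable Omega (fun x => (v x ^+ 2)%:E).
Proof.
move=> /Lfun2_integrable_sqr vi.
rewrite -(setTI Omega); apply/(integrable_restrict _ mO measurableT).
rewrite (_ : _ \_ _ = EFin \o (fun x => (v \_ Omega) x ^+ 2))//.
apply/funext => x; rewrite /= !patchE; case: ifPn => // _.
by rewrite expr0n.
Qed.

Lemma L2_integrableM u v : L2 Omega u -> L2 Omega v ->
  mu.-integrable Omega (fun x => (u x * v x)%:E).
Proof.
move=> uL vL; have mu_ := L2_measurable uL; have mv := L2_measurable vL.
apply: (le_integrable mO _ _ (integrableD mO (L2_integrable_sqr uL) (L2_integrable_sqr vL))).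
  by apply/measurable_EFinP; exact: measurable_funM.
move=> x Ox; rewrite lee_fin [leRHS]ger0_norm ?addr_ge0 ?sqr_ge0//.
by rewrite ler_norml; apply/andP; split; nra.
Qed.

Lemma integrable_sqr_L2 v : measurable_fun Omega v ->
  mu.-integrable Omega (fun x => (v x ^+ 2)%:E) -> L2 Omega v.
Proof.
move=> mv vi; rewrite /L2 inE; apply/andP; split; rewrite inE/=.
  by apply/(measurable_restrictT _ mO).
have := L2norm_integral v; rewrite /finite_norm /L2norm => ->.
by rewrite poweR_lty// integrable_lty.
Qed.

Lemma L2norm_sqrt v : mu.-integrable Omega (fun x => (v x ^+ 2)%:E) ->
  L2norm Omega v = (Num.sqrt (\int[mu]_(x in Omega) (v x ^+ 2)))%:E.
Proof.
move=> vi; rewrite L2norm_integral -[X in (X `^ _)%E]fineK ?integrable_fin_num//.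
by rewrite poweR_EFin powR12_sqrt// Rintegral_ge0// => x _; exact: sqr_ge0.
Qed.

Lemma L2B u v : L2 Omega u -> L2 Omega v -> L2 Omega (fun x => u x - v x).
Proof.
move=> uL vL; have mu_ := L2_measurable uL; have mv := L2_measurable vL.
have m : measurable_fun Omega (fun x => u x - v x) by exact: measurable_funB.
apply: integrable_sqr_L2 => //.
have i := integrableD mO (L2_integrable_sqr uL) (L2_integrable_sqr vL).
apply: (le_integrable mO _ _ (integrableD mO i i)).
  by apply/measurable_EFinP; exact: measurable_funX.
move=> x Ox; rewrite lee_fin.
rewrite [leRHS]ger0_norm ?addr_ge0 ?sqr_ge0//.
rewrite ger0_norm ?sqr_ge0//.
have := sqr_ge0 (u x + v x); nra.
Qed.

(** Young's inequality with a free parameter, applied pointwise. It serves in place of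
    Cauchy-Schwarz: [t] is tuned to the smallness of the first factor. *)
Lemma Rintegral_mul_le u v (t : R) : 0 < t -> L2 Omega u -> L2 Omega v ->
  `|\int[mu]_(x in Omega) (u x * v x)| <=
  t^-1 * \int[mu]_(x in Omega) (u x ^+ 2) + t * \int[mu]_(x in Omega) (v x ^+ 2).
Proof.
move=> t0 uL vL; have iuv := L2_integrableM uL vL.
have iu := L2_integrable_sqr uL; have iv := L2_integrable_sqr vL.
apply: (le_trans (le_normr_Rintegral mO iuv)).
rewrite -!RintegralZl// -RintegralD//; last 2 first.
- exact: (integrableZl mO _ iu).
- exact: (integrableZl mO _ iv).
apply: le_Rintegral => //.
- exact: (integrable_norm iuv).
- exact: (integrableD mO (integrableZl mO _ iu) (integrableZl mO _ iv)).
move=> x Ox; set a := u x; set b := v x.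
(* In terms of [c = a / t] both sides carry the factor [t], and what remains is
   [|c b| <= c^2 + b^2]. *)
have -> : t^-1 * a ^+ 2 = t * (t^-1 * a) ^+ 2.
  by rewrite exprMn expr2 !mulrA divff ?gt_eqF// mul1r -!mulrA.
have {1}-> : a = t * (t^-1 * a) by rewrite mulrA divff ?gt_eqF// mul1r.
set c := t^-1 * a; rewrite -mulrA normrM gtr0_norm// -mulrDr ler_pM2l//.
by rewrite ler_norml; apply/andP; split; nra.
Qed.

End L2_theory.

(** * Weak derivatives *)

Section test_functions.
Context (R : realType) (n : nat) (Omega : set 'rV[R]_n).
Hypotheses (oO : open Omega) (bO : bounded_set Omega).
Local Notation mu := (lebesgue_rV R n).
Implicit Types f u v phi psi h : 'rV[R]_n -> R.

Let mO : measurable Omega := measurable_open_rV oO.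
Let Ooo : (mu Omega < +oo)%E := lebesgue_rV_bounded mO bO.

Lemma test_function_outside phi : test_function Omega phi ->
  forall x, ~ Omega x -> phi x = 0.
Proof.
move=> [_ _ sO] x Ox; apply/eqP; apply: contrapT => /negP px; apply: Ox.
by apply: sO; apply: subset_closure.
Qed.

Lemma test_function_mul phi f : test_function Omega phi -> smooth_algebra f ->
  test_function Omega (fun x => f x * phi x).
Proof.
move=> [sp cp pO] af.
have sub : closure [set x | f x * phi x != 0] `<=` closure [set x | phi x != 0].
  by apply: closure_subset => x /=; apply: contra_neq => ->; rewrite mulr0.
split; last exact: subset_trans sub pO.
  by apply: smooth_algebraW; apply: smooth_algebraM => //; exact: smooth_algebra_smooth.
exact: subclosed_compact (@closed_closure _ _) cp sub.
Qed.

Lemma bounded_L2 f C : measurable_fun Omega f -> (forall x, Omega x -> `|f x| <= C) ->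
  L2 Omega f.
Proof.
move=> mf fC; apply: (integrable_sqr_L2 mO) => //.
apply: (@bounded_integrable _ _ _ mu _ (fun x => f x ^+ 2) (C ^+ 2)) => //.
  exact: measurable_funX.
move=> x Ox; rewrite normrX lerXn2r ?nnegrE//; first exact: le_trans (fC x Ox).
exact: fC.
Qed.

Lemma continuous_L2 f : continuous f -> L2 Omega f.
Proof.
move=> cf; have [C fC] := continuous_bounded_on cf bO.
by apply: (@bounded_L2 _ C) => //; apply: measurable_funTS; exact: measurable_cont_rVT.
Qed.

Lemma smooth_L2 f : smooth f -> L2 Omega f.
Proof. by move=> sf; apply: continuous_L2; exact: smooth_continuous. Qed.

(* Since v is a limit of test functions, it cannot distinguish two weak
   derivatives of the same function: they agree as distributions. *)
Lemma weak_partial_integral_unique j psi h h' v :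
  L2 Omega v -> L2 Omega h -> L2 Omega h' ->
  weak_partial Omega j psi h -> weak_partial Omega j psi h' ->
  (forall eps : R, 0 < eps -> exists2 phi, test_function Omega phi &
     \int[mu]_(x in Omega) ((v x - phi x) ^+ 2) <= eps ^+ 2) ->
  \int[mu]_(x in Omega) (v x * h x) = \int[mu]_(x in Omega) (v x * h' x).
Proof.
move=> vL hL h'L wh wh' vphi.
pose k x := h x - h' x; have kL : L2 Omega k by exact: L2B.
have K0 : 0 <= \int[mu]_(x in Omega) (k x ^+ 2).
  by apply: Rintegral_ge0 => x _; exact: sqr_ge0.
apply/eqP; rewrite -subr_eq0 -normr_eq0 eq_le normr_ge0 andbT; apply/ler_addgt0Pl => e e0; rewrite addr0.
(* Where the integral of [(v - phi)^2] is at most [t^2], Young's inequality at [t] gives [t] times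
   [1] plus the integral of [k^2], which this choice makes equal to [e]. *)
pose t := e / (1 + \int[mu]_(x in Omega) (k x ^+ 2)).
have t0 : 0 < t by rewrite divr_gt0// ltr_pwDl.
have [phi tphi vp] := vphi t t0.
have pL : L2 Omega phi by apply: smooth_L2; case: tphi.
have vpL : L2 Omega (fun x => v x - phi x) by exact: L2B.
have -> : \int[mu]_(x in Omega) (v x * h x) - \int[mu]_(x in Omega) (v x * h' x) =
    \int[mu]_(x in Omega) ((v x - phi x) * k x).
  rewrite -RintegralB//; [|exact: L2_integrableM|exact: L2_integrableM].
  have /eqP : \int[mu]_(x in Omega) (phi x * h x) - \int[mu]_(x in Omega) (phi x * h' x) = 0.
    apply/eqP; rewrite subr_eq0; apply/eqP/oppr_inj.
    under eq_Rintegral do rewrite mulrC.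
    rewrite -wh// wh'//; congr (- _).
    by apply: eq_Rintegral => x _; rewrite mulrC.
  rewrite -RintegralB//; [|exact: L2_integrableM|exact: L2_integrableM].
  move=> /eqP p0; rewrite -[LHS]subr0 -p0 -RintegralB//.
  - by apply: eq_Rintegral => x _; rewrite /k; ring.
  - exact: (integrableB mO (L2_integrableM mO vL hL) (L2_integrableM mO vL h'L)).
  - exact: (integrableB mO (L2_integrableM mO pL hL) (L2_integrableM mO pL h'L)).
apply: (le_trans (Rintegral_mul_le mO t0 vpL kL)).
apply: (@le_trans _ _ (t + t * \int[mu]_(x in Omega) (k x ^+ 2))).
  by rewrite lerD2r ler_pdivrMl// -expr2.
by rewrite -{1}[t]mulr1 -mulrDr /t divfK// gt_eqF// ltr_pwDl.
Qed.

End test_functions.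

Section weak_perp_grad.
Context (R : realType) (n : nat) (Omega : set 'rV[R]_n).
Hypotheses (oO : open Omega) (bO : bounded_set Omega).
Local Notation mu := (lebesgue_rV R n).
Implicit Types f u v phi psi h : 'rV[R]_n -> R.

Let mO : measurable Omega := measurable_open_rV oO.

(** The pairings for [v] and [v - phi] come with unrelated weak derivatives [h] and [h'] of the same
    function. Against [v] these are interchangeable; after the exchange only minus the integral of
    [h' phi] is left, and the defining property of [h'], tested on [phi] itself, turns it into a
    classical integral. *)
Lemma perp_grad_test b v phi g g' :
  (forall eps : R, 0 < eps -> exists2 phi, test_function Omega phi &
     \int[mu]_(x in Omega) ((v x - phi x) ^+ 2) <= eps ^+ 2) ->
  L2 Omega v -> test_function Omega phi ->
  is_perp_grad Omega b v g -> is_perp_grad Omega b (fun x => v x - phi x) g' ->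
  forall i psi, test_function Omega psi ->
  \int[mu]_(x in Omega) (g x ord0 i * psi x) -
  \int[mu]_(x in Omega) (g' x ord0 i * psi x) =
  \sum_j \int[mu]_(x in Omega) (perp_proj (b x) i j * psi x * partial j phi x).
Proof.
move=> vphi vL tphi [_ gP] [_ g'P] i psi tpsi.
have [r [rP ->]] := gP i psi tpsi; have [r' [r'P ->]] := g'P i psi tpsi.
have pL : L2 Omega phi by apply: smooth_L2 => //; case: tphi.
rewrite -sumrB; apply: eq_bigr => j _.
have [h [hL wh ->]] := rP j; have [h' [h'L wh' ->]] := r'P j.
rewrite (weak_partial_integral_unique oO bO vL hL h'L wh wh' vphi) wh'//.
have -> : \int[mu]_(x in Omega) ((v x - phi x) * h' x) =
    \int[mu]_(x in Omega) (v x * h' x) - \int[mu]_(x in Omega) (h' x * phi x).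
  rewrite -RintegralB//; [|exact: L2_integrableM|exact: L2_integrableM].
  by apply: eq_Rintegral => x _; ring.
by ring.
Qed.

End weak_perp_grad.

(** * The weighted energy estimate *)

Lemma integrable_rsum (R : realType) d (T : measurableType d)
    (mu : {measure set T -> \bar R}) (D : set T) (I : Type) (s : seq I) (f : I -> T -> R) :
  measurable D -> (forall i, mu.-integrable D (EFin \o f i)) ->
  mu.-integrable D (EFin \o (fun x => \sum_(i <- s) f i x)).
Proof.
move=> mD fi; rewrite (_ : _ \o _ = (fun x => \sum_(i <- s) (f i x)%:E)%E).
  exact: (integrable_sum mD s (fun i _ => fi i)).
by apply/funext => x /=; rewrite sumEFin.
Qed.

Lemma Rintegral_sum (R : realType) d (T : measurableType d)
    (mu : {measure set T -> \bar R}) (D : set T) (I : Type) (s : seq I) (f : I -> T -> R) :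
  measurable D -> (forall i, mu.-integrable D (EFin \o f i)) ->
  \int[mu]_(x in D) (\sum_(i <- s) f i x) = \sum_(i <- s) \int[mu]_(x in D) f i x.
Proof.
move=> mD fi; elim: s => [|i s IH].
  under eq_Rintegral do rewrite big_nil.
  by rewrite big_nil /Rintegral integral0.
under eq_Rintegral do rewrite big_cons.
by rewrite big_cons RintegralD// ?IH//; exact: integrable_rsum.
Qed.

Lemma continuous_funM (T : topologicalType) (R : realType) (f g : T -> R) :
  continuous f -> continuous g -> continuous (fun x => f x * g x).
Proof. by move=> cf cg x; exact: (cvgM (cf x) (cg x)). Qed.

Lemma continuous_funD (T : topologicalType) (R : realType) (f g : T -> R) :
  continuous f -> continuous g -> continuous (fun x => f x + g x).
Proof. by move=> cf cg x; exact: (cvgD (cf x) (cg x)). Qed.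

(** * The Euclidean inner product and the matrix Id - u^T u *)

Section dot_theory.
Context (R : realType) (n : nat).
Implicit Types u v w : 'rV[R]_n.

Lemma dotC u v : dot u v = dot v u.
Proof. by apply: eq_bigr => i _; rewrite mulrC. Qed.

Lemma dotDl u v w : dot (u + v) w = dot u w + dot v w.
Proof. by rewrite /dot -big_split; apply: eq_bigr => i _; rewrite mxE mulrDl. Qed.

Lemma dotZl (a : R) u w : dot (a *: u) w = a * dot u w.
Proof. by rewrite /dot mulr_sumr; apply: eq_bigr => i _; rewrite mxE mulrA. Qed.

Lemma dotBl u v w : dot (u - v) w = dot u w - dot v w.
Proof. by rewrite dotDl -scaleN1r dotZl mulN1r. Qed.

Lemma dotBr u v w : dot w (u - v) = dot w u - dot w v.
Proof. by rewrite ![dot w _]dotC dotBl. Qed.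

Lemma dotZr (a : R) u w : dot w (a *: u) = a * dot w u.
Proof. by rewrite dotC dotZl dotC. Qed.

Lemma dot_ge0 u : 0 <= dot u u.
Proof. by apply: sumr_ge0 => i _; rewrite -expr2 sqr_ge0. Qed.

Lemma dot_basis i w : dot (basis_vec R i) w = w ord0 i.
Proof.
rewrite /dot (bigD1 i)//= mxE !eqxx mul1r big1 ?addr0// => j ji.
by rewrite mxE (negbTE ji) andbF mul0r.
Qed.

Lemma enorm_sqr u : enorm u ^+ 2 = dot u u.
Proof. by rewrite sqr_sqrtr// dot_ge0. Qed.

(** The component of [v] orthogonal to the unit vector [u] has nonnegative squared length. *)
Lemma dot_sqr_le u v : dot u u = 1 -> dot u v ^+ 2 <= dot v v.
Proof.
move=> u1; have := dot_ge0 (v - dot u v *: u).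
rewrite dotBl !dotBr !dotZl !dotZr u1 [dot v u]dotC.
by rewrite mulr1 subrr subr0 subr_ge0 expr2.
Qed.

Lemma dot_sqrB_le u v : dot (u - v) (u - v) <= 2 * dot u u + 2 * dot v v.
Proof.
have := dot_ge0 (u + v); rewrite !dotBl !dotBr !dotDl ![dot _ (u + v)]dotC !dotDl.
by rewrite [dot v u]dotC; lra.
Qed.

Lemma coord_sqr_le u i : u ord0 i ^+ 2 <= dot u u.
Proof.
rewrite /dot (bigD1 i)//= expr2 lerDl; apply: sumr_ge0 => j _.
by rewrite -expr2 sqr_ge0.
Qed.

Lemma perp_projE u i j : perp_proj u i j = (i == j)%:R - u ord0 i * u ord0 j.
Proof. by rewrite !mxE big_ord1 !mxE. Qed.

Lemma perp_proj_orthogonal u v j : dot v u = 0 ->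
  \sum_i v ord0 i * perp_proj u i j = v ord0 j.
Proof.
move=> vu; under eq_bigr do rewrite perp_projE mulrBr mulrA.
rewrite sumrB -mulr_suml [X in _ - X * _](_ : _ = 0) ?mul0r ?subr0//.
rewrite (bigD1 j)//= eqxx mulr1 big1 ?addr0// => i ij.
by rewrite (negbTE ij) mulr0.
Qed.

Lemma continuous_dotr w : continuous (fun x : 'rV[R]_n => dot x w).
Proof.
apply: continuous_big => [x|i _]; first exact: add_continuous.
by apply: continuous_funM => x; [exact: coord_continuous|exact: cst_continuous].
Qed.

End dot_theory.

Section exponential_weight.
Context (R : realType) (n : nat) (lambda : R) (w : 'rV[R]_n).

Definition exp_weight (x : 'rV[R]_n) : R := expR (lambda * dot x w).

Lemma exp_weight_continuous : continuous exp_weight.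
Proof.
move=> x; apply: (@continuous_comp _ _ _ (fun x => lambda * dot x w) expR).
  apply: (@continuous_funM _ _ (fun=> lambda)); last exact: continuous_dotr.
  by move=> y; exact: cst_continuous.
exact: continuous_expR.
Qed.

Lemma exp_weight_is_derive x i :
  is_derive x (basis_vec R i) exp_weight (lambda * w ord0 i * exp_weight x).
Proof.
have := is_derive_expR_affine (lambda * dot x w) (lambda * w ord0 i) 0.
rewrite mulr0 addr0; apply: is_derive_transport => h.
by rewrite /exp_weight addr0 dotDl dotZl dot_basis [h *: 1]mulr1; congr expR; ring.
Qed.

End exponential_weight.

(** A row vector multiplies the Jacobian from the left, so rows index the directions of
    differentiation and columns the components. *)
Lemma coord_is_derive (R : realType) (m n : nat) (f : 'rV[R]_m.+1 -> 'rV[R]_n.+1) x i j :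
  differentiable f x ->
  is_derive x (basis_vec R i) (fun y => f y ord0 j) ('J f x i j).
Proof.
move=> df; have dfj : differentiable (fun y => f y ord0 j) x.
  exact: (differentiable_comp df (differentiable_coord_rV j (f x))).
have -> : 'J f x i j = 'D_(basis_vec R i) (fun y => f y ord0 j) x.
  have := deriveEjacobian (basis_vec R i) df.
  rewrite derive_mx; last exact: diff_derivable.
  move=> /matrixP /(_ ord0 j); rewrite mxE => ->.
  by rewrite -rowE [RHS]mxE.
exact: diff_is_derive.
Qed.

Section energy.
Context (R : realType) (n : nat) (Omega : set 'rV[R]_n.+1).
Hypotheses (oO : open Omega) (bO : bounded_set Omega).
Local Notation mu := (lebesgue_rV R n.+1).
Variables (bn : 'rV[R]_n.+1 -> 'rV[R]_n.+1) (w : 'rV[R]_n.+1) (alpha M lambda : R).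
Hypotheses (dbn : forall x, differentiable bn x) (cJ : continuous (jacobian bn)).
Hypotheses (JM : forall x, `|'J bn x| <= M) (lambda0 : 0 <= lambda).
Hypotheses (bnw : forall x, alpha <= dot (bn x) w).
Hypothesis lambda_large : n.+1%:R * M + 1 <= lambda * alpha.
Local Notation h := (exp_weight lambda w).

Let mO : measurable Omega := measurable_open_rV oO.

Definition grad (phi : 'rV[R]_n.+1 -> R) x : 'rV[R]_n.+1 := \row_i partial i phi x.

(** The norm of a matrix is its largest absolute entry, so [M] bounds each of the [n.+1] diagonal
    entries. *)
Lemma divergence_ge x : - (n.+1%:R * M) <= \sum_i 'J bn x i i.
Proof.
rewrite -mulrN -[n.+1 in leLHS]card_ord mulr_natl -sumr_const; apply: ler_sum => i _.
rewrite lerNl; apply: le_trans (JM x); apply: le_trans (ler_norm _) _; rewrite normrN.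
by rewrite {2}/Num.norm/= mx_normrE; apply: (le_bigmax _ (fun p => `|'J bn x p.1 p.2|) (i, i)).
Qed.

Lemma weighted_energy_le phi : test_function Omega phi ->
  \int[mu]_(x in Omega) (h x * phi x ^+ 2) <=
  - 2 * \int[mu]_(x in Omega) (h x * phi x * dot (bn x) (grad phi x)).
Proof.
move=> tphi; have [sphi _ _] := tphi.
have phi0 := test_function_outside tphi.
have [K0 [_ K0O]] := bO; pose K := `|K0| + 1.
have OK x : K < `|x| -> ~ Omega x.
  have K0K : K0 < K by rewrite (le_lt_trans (ler_norm K0))// ltrDl.
  by move=> Kx /(K0O K K0K) /=; rewrite leNgt Kx.
have ch := @exp_weight_continuous R n.+1 lambda w.
have cphi := smooth_continuous sphi.
have cpart i := smooth_continuous (smooth_partial i sphi).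
have cbn i : continuous (fun x => bn x ord0 i).
  move=> x; apply: differentiable_continuous.
  exact: (differentiable_comp (dbn x) (differentiable_coord_rV i (bn x))).
have cJi i : continuous (fun x => 'J bn x i i).
  move=> x; apply: (@continuous_comp _ _ _ (jacobian bn) (fun A => A i i)); first exact: cJ.
  exact: coord_continuous.
(* [F i] is the i-th component of h phi^2 b_n and [Q i] its i-th partial derivative, in the shape in
   which the product rule yields it. *)
pose F i x := h x * (bn x ord0 i * (phi x * phi x)).
pose Q i x := h x * (bn x ord0 i * (phi x * partial i phi x + phi x * partial i phi x) +
                 phi x * phi x * 'J bn x i i) +
              bn x ord0 i * (phi x * phi x) * (lambda * w ord0 i * h x).
have dF i x : is_derive x (basis_vec R i) (F i) (Q i x).
  have dphi := diff_is_derive (basis_vec R i) (smooth_differentiable sphi x).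
  apply: (is_deriveM (exp_weight_is_derive lambda w x i)).
  by apply: (is_deriveM (coord_is_derive i i (dbn x))); exact: is_deriveM.
have cQ i : continuous (Q i).
  have c2 : continuous (fun x => phi x * phi x) by exact: continuous_funM.
  apply: continuous_funD.
    apply: continuous_funM => //; apply: continuous_funD; apply: continuous_funM => //.
    by apply: continuous_funD; exact: continuous_funM.
  apply: continuous_funM; first exact: continuous_funM.
  by apply: continuous_funM => // x; exact: cst_continuous.
have Q0 i x : ~ Omega x -> Q i x = 0.
  by move=> /phi0 p0; rewrite /Q p0; ring.
have iQ i : mu.-integrable Omega (EFin \o Q i).
  apply: (integrableS measurableT) => //.
  by apply: (@vanish_integrable _ _ _ K) => // x /OK; exact: Q0.
have intQ i : \int[mu]_(x in Omega) Q i x = 0.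
  (* As [Q i] vanishes off [Omega], its integral is one over the whole space, where no boundary term
     arises. *)
  rewrite Rintegral_mkcond /Rintegral.
  under eq_integral => x _.
    have -> : (Q i \_ Omega) x = Q i x.
      by rewrite patchE; case: ifPn => //; rewrite notin_setE => /Q0.
    over.
  rewrite (integral_partial_vanish (dF i) (cQ i) (K := K))//.
    by move=> x /OK /phi0 p0; rewrite /F p0; ring.
  by move=> x /OK; exact: Q0.
have ih : mu.-integrable Omega (EFin \o (fun x => h x * phi x ^+ 2)).
  rewrite (_ : _ \o _ = fun x => ((h x * phi x) * phi x)%:E).
    apply: (L2_integrableM mO); apply: continuous_L2 => //.
    exact: continuous_funM.
  by apply/funext => x /=; rewrite expr2 mulrA.
have ig : mu.-integrable Omega (EFin \o (fun x => h x * phi x * dot (bn x) (grad phi x))).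
  rewrite (_ : _ \o _ = fun x => ((h x * phi x) * dot (bn x) (grad phi x))%:E)//.
  apply: (L2_integrableM mO); apply: continuous_L2 => //.
    exact: continuous_funM.
  rewrite /dot; apply: continuous_big => [x|i _]; first exact: add_continuous.
  apply: continuous_funM; first exact: cbn.
  rewrite (_ : (fun _ => _) = partial i phi); first exact: cpart.
  by apply/funext => y; rewrite mxE.
have sumQ : \int[mu]_(x in Omega) (\sum_i Q i x) = 0.
  by rewrite Rintegral_sum// big1.
suff : \int[mu]_(x in Omega) (h x * phi x ^+ 2) +
    2 * \int[mu]_(x in Omega) (h x * phi x * dot (bn x) (grad phi x)) <= 0 by lra.
have i2g := integrableZl mO 2 ig.
rewrite -sumQ -RintegralZl// -RintegralD//.
apply: le_Rintegral => //.
- exact: (integrableD mO ih i2g).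
- exact: integrable_rsum.
move=> x Ox.
(* The last bracket is at least 1, because [lambda * alpha] exceeds the bound on the divergence by
   at least 1. *)
have -> : \sum_i Q i x = 2 * (h x * phi x * dot (bn x) (grad phi x)) +
    h x * phi x ^+ 2 * (\sum_i 'J bn x i i + lambda * dot (bn x) w).
  rewrite /dot !mulr_sumr -big_split/= !mulr_sumr -big_split/=.
  by apply: eq_bigr => i _; rewrite mxE /Q; ring.
rewrite addrC lerD2l ler_peMr//; first by rewrite mulr_ge0 ?sqr_ge0 ?expR_ge0.
have H1 := divergence_ge x.
have H2 : lambda * alpha <= lambda * dot (bn x) w by rewrite ler_wpM2l.
by move: lambda_large H1 H2; move: (n.+1%:R * M) => N; lra.
Qed.

End energy.

(** * The Poincare inequality *)

(** The field is controlled on [Omega] only; since [Omega] is open, the Lipschitz bound still gives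
    continuity at each of its points. *)
Lemma lipschitz_measurable_coord (R : realType) (m n : nat) (Omega : set 'rV[R]_m)
    (f : 'rV[R]_m -> 'rV[R]_n) i :
  open Omega -> [lipschitz f x | x in Omega] ->
  measurable_fun Omega (fun x => f x ord0 i).
Proof.
move=> oO [M0 [_ /(_ (`|M0| + 1))]].
have K0 : 0 < `|M0| + 1 by rewrite ltr_wpDl.
have -> : M0 < `|M0| + 1 by rewrite (le_lt_trans (ler_norm M0))// ltrDl.
move=> /(_ isT) fK; apply: measurable_cont_rV => // x Ox U /nbhs_ballP[e e0 eU].
have := open_nbhs_nbhs (conj oO Ox); move=> /nbhs_ballP[r r0 rO].
apply/nbhs_ballP; exists (Num.min r (e / (`|M0| + 1))) => /=.
  by rewrite lt_min r0 divr_gt0.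
move=> y /= xy; apply: eU; rewrite /ball/=.
have Oy : Omega y by apply: rO; apply: le_ball xy; rewrite ge_min lexx.
have := fK (x, y) (conj Ox Oy) => /= fxy.
have -> : f x ord0 i - f y ord0 i = (f x - f y) ord0 i by rewrite !mxE.
apply: le_lt_trans (ler_coord_norm _ _) _; apply: le_lt_trans fxy _.
rewrite mulrC -ltr_pdivlMr//.
have : ball x (e / (`|M0| + 1)) y by apply: le_ball xy; rewrite ge_min lexx orbT.
by rewrite -ball_normE.
Qed.

Lemma integrable_dot_sqr (R : realType) (n : nat) (Omega : set 'rV[R]_n)
    (f : 'rV[R]_n -> 'rV[R]_n) : measurable Omega -> L2vec Omega f ->
  (lebesgue_rV R n).-integrable Omega (EFin \o (fun x => dot (f x) (f x))).
Proof.
move=> mO fL; apply: integrable_rsum => // i.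
by apply: eq_integrable (L2_integrable_sqr mO (fL i)) => // x _; rewrite expr2.
Qed.

Lemma L2vecnorm_sqrt (R : realType) (n : nat) (Omega : set 'rV[R]_n)
    (f : 'rV[R]_n -> 'rV[R]_n) : measurable Omega -> L2vec Omega f ->
  L2vecnorm Omega f =
    (Num.sqrt (\int[lebesgue_rV R n]_(x in Omega) dot (f x) (f x)))%:E.
Proof.
move=> mO fL; rewrite /L2vecnorm L2norm_sqrt//.
  by under eq_Rintegral do rewrite enorm_sqr.
by apply: eq_integrable (integrable_dot_sqr mO fL) => // x _ /=; rewrite enorm_sqr.
Qed.

(** * The inequality for test functions, with and without weight *)

Section estimate.
Context (R : realType) (n : nat) (Omega : set 'rV[R]_n.+1).
Hypotheses (oO : open Omega) (bO : bounded_set Omega).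
Local Notation mu := (lebesgue_rV R n.+1).
Variables (bn : 'rV[R]_n.+1 -> 'rV[R]_n.+1) (w : 'rV[R]_n.+1) (alpha M lambda : R).
Hypotheses (dbn : forall x, differentiable bn x) (cJ : continuous (jacobian bn)).
Hypotheses (JM : forall x, `|'J bn x| <= M) (lambda0 : 0 <= lambda).
Hypotheses (bnw : forall x, alpha <= dot (bn x) w).
Hypothesis lambda_large : n.+1%:R * M + 1 <= lambda * alpha.
Local Notation h := (exp_weight lambda w).

Let mO : measurable Omega := measurable_open_rV oO.

Variables (b : 'rV[R]_n.+1 -> 'rV[R]_n.+1).
Hypotheses (mb : forall i, measurable_fun Omega (fun x => b x ord0 i)).
Hypotheses (b1 : forall x, Omega x -> dot (b x) (b x) = 1).
Hypotheses (bn1 : forall x, Omega x -> dot (bn x) (bn x) = 1).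
Hypotheses (bnb : forall x, Omega x -> dot (bn x) (b x) = 0).

Lemma perp_proj_bounded x i j : Omega x -> `|perp_proj (b x) i j| <= 2.
Proof.
move=> Ox; have bi k : `|b x ord0 k| <= 1.
  by rewrite -(@expr_le1 _ 2)// real_normK ?num_real// -(b1 Ox) coord_sqr_le.
rewrite perp_projE; apply: le_trans (ler_normB _ _) _.
rewrite (_ : 2 = 1 + 1)//; apply: lerD.
  by case: (i == j); rewrite ?normr1 ?normr0.
by rewrite normrM mulr_ile1.
Qed.

Lemma measurable_perp_proj i j : measurable_fun Omega (fun x => perp_proj (b x) i j).
Proof.
rewrite (_ : (fun _ => _) = (fun x => (i == j)%:R - b x ord0 i * b x ord0 j)).
  by apply: measurable_funB; [exact: measurable_cst|exact: measurable_funM].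
by apply/funext => x; rewrite perp_projE.
Qed.

Variables (phi : 'rV[R]_n.+1 -> R) (G : 'rV[R]_n.+1 -> 'rV[R]_n.+1).
Hypotheses (tphi : test_function Omega phi) (GL : L2vec Omega G).
Hypothesis Gphi : forall i psi, test_function Omega psi ->
  \int[mu]_(x in Omega) (G x ord0 i * psi x) =
  \sum_j \int[mu]_(x in Omega) (perp_proj (b x) i j * psi x * partial j phi x).

Lemma integrable_perp_proj i j psi : smooth psi ->
  mu.-integrable Omega (EFin \o (fun x => perp_proj (b x) i j * psi x * partial j phi x)).
Proof.
move=> spsi; apply: (L2_integrableM mO); last first.
  by apply: smooth_L2 => //; apply: smooth_partial; case: tphi.
have [C psiC] := continuous_bounded_on (smooth_continuous spsi) bO.
apply: (@bounded_L2 _ _ _ oO bO _ (2 * C)).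
  apply: measurable_funM; first exact: measurable_perp_proj.
  by apply: measurable_funTS; apply: measurable_cont_rVT; exact: smooth_continuous.
move=> x Ox; rewrite normrM; apply: ler_pM => //; first exact: perp_proj_bounded.
exact: psiC.
Qed.

(* The field [h phi bn], being only C^1, is not an admissible test function; hence
   the detour through an almost everywhere identity. *)
Lemma perp_grad_test_ae i :
  ae_eq mu Omega (EFin \o (fun x => (G x ord0 i -
    \sum_j perp_proj (b x) i j * partial j phi x) * phi x)) (cst 0%E).
Proof.
have [sphi _ _] := tphi; have pL := smooth_L2 oO bO sphi.
have E f x : f x * ((G x ord0 i - \sum_j perp_proj (b x) i j * partial j phi x) * phi x) =
    G x ord0 i * (f x * phi x) -
    \sum_j perp_proj (b x) i j * (f x * phi x) * partial j phi x.
  rewrite mulrBl mulrBr; congr (_ - _); first by rewrite mulrCA.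
  by rewrite mulr_suml mulr_sumr; apply: eq_bigr => j _; ring.
have I f : smooth f -> mu.-integrable Omega (EFin \o (fun x => G x ord0 i * f x)).
  by move=> sf; apply: (L2_integrableM mO) => //; exact: smooth_L2.
have J f : smooth f -> mu.-integrable Omega
    (EFin \o (fun x => \sum_j perp_proj (b x) i j * f x * partial j phi x)).
  by move=> sf; apply: integrable_rsum => // j; exact: integrable_perp_proj.
apply: ae_eq0_smooth_algebra => //.
- apply: eq_integrable (integrableB mO (I _ sphi) (J _ sphi)) => // x _ /=.
  rewrite -EFinB; congr EFin; have := E (fun=> 1) x; rewrite !mul1r => ->.
  by congr (_ - _); apply: eq_bigr => j _; rewrite mul1r.
- move=> f af _; have tfphi := test_function_mul tphi af.
  have [sfphi _ _] := tfphi.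
  under eq_Rintegral do rewrite E.
  rewrite RintegralB//; [|exact: I|exact: J].
  rewrite Rintegral_sum//; last by move=> j; exact: integrable_perp_proj.
  by rewrite Gphi// subrr.
Qed.

Let ch : continuous h := @exp_weight_continuous R n.+1 lambda w.

Let cbn i : continuous (fun x => bn x ord0 i).
Proof.
move=> x; apply: differentiable_continuous.
exact: (differentiable_comp (dbn x) (differentiable_coord_rV i (bn x))).
Qed.

Let cphi : continuous phi.
Proof. by apply: smooth_continuous; case: tphi. Qed.

Let L2hphi : L2 Omega (fun x => h x * phi x).
Proof. by apply: continuous_L2 => //; exact: continuous_funM. Qed.

Lemma integrable_weight_dot :
  mu.-integrable Omega (EFin \o (fun x => h x * phi x * dot (bn x) (G x))).
Proof.
have -> : (fun x => h x * phi x * dot (bn x) (G x)) =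
    (fun x => \sum_i (h x * phi x * bn x ord0 i) * G x ord0 i).
  by apply/funext => x; rewrite /dot mulr_sumr; apply: eq_bigr => i _; rewrite mulrA.
apply: integrable_rsum => // i; apply: (L2_integrableM mO) => //.
by apply: continuous_L2 => //; apply: continuous_funM => //; exact: continuous_funM.
Qed.

(** [G] is known to agree with the classical perpendicular gradient only almost everywhere on the
    set where [phi] is nonzero. This is enough, because both integrands contain the factor [phi]. *)
Lemma weight_dot_perp_grad :
  \int[mu]_(x in Omega) (h x * phi x * dot (bn x) (grad phi x)) =
  \int[mu]_(x in Omega) (h x * phi x * dot (bn x) (G x)).
Proof.
rewrite /Rintegral; congr fine; apply: ae_eq_integral => //.
- apply/measurable_EFinP; apply: measurable_funTS; apply: measurable_cont_rVT.
  apply: continuous_funM; first exact: continuous_funM.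
  rewrite /dot; apply: continuous_big => [x|i _]; first exact: add_continuous.
  apply: continuous_funM => //.
  rewrite (_ : (fun _ => _) = partial i phi).
    by apply: smooth_continuous; apply: smooth_partial; case: tphi.
  by apply/funext => y; rewrite mxE.
- exact: (measurable_int mu integrable_weight_dot).
(* There are finitely many components, so one null set serves for all of them. *)
have H : \forall x \ae mu, forall i, Omega x -> (G x ord0 i -
    \sum_j perp_proj (b x) i j * partial j phi x) * phi x = 0.
  apply: filter_forall => i; apply: filterS (perp_grad_test_ae i) => x Hx Ox.
  by have [] := Hx Ox.
apply: filterS H => x Hx Ox /=; congr EFin.
apply/eqP; rewrite eq_sym -subr_eq0; apply/eqP.
transitivity (\sum_i h x * bn x ord0 i * ((G x ord0 i -
    \sum_j perp_proj (b x) i j * partial j phi x) * phi x)); last first.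
  by rewrite big1// => i _; rewrite Hx// mulr0.
have -> : dot (bn x) (grad phi x) =
    \sum_i bn x ord0 i * \sum_j perp_proj (b x) i j * partial j phi x.
  under [RHS]eq_bigr do rewrite mulr_sumr.
  rewrite exchange_big; apply: eq_bigr => j _; rewrite mxE.
  rewrite -[in LHS](perp_proj_orthogonal j (bnb Ox)) mulr_suml.
  by apply: eq_bigr => i _; rewrite mulrA.
rewrite -mulrBr /dot -sumrB mulr_sumr; apply: eq_bigr => i _; ring.
Qed.

Lemma integrable_weight_dot_sqr :
  mu.-integrable Omega (EFin \o (fun x => h x * dot (G x) (G x))).
Proof.
have [C hC] := continuous_bounded_on ch bO.
have iG := integrable_dot_sqr mO GL.
apply: (le_integrable mO _ _ (integrableZl mO C iG)).
  apply/measurable_EFinP; apply: measurable_funM.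
    by apply: measurable_funTS; exact: measurable_cont_rVT.
  by apply/measurable_EFinP; exact: (measurable_int mu iG).
move=> x Ox; rewrite lee_fin !normrM ler_wpM2r//.
exact: le_trans (hC x Ox) (ler_norm C).
Qed.

Lemma integrable_weight_sqr :
  mu.-integrable Omega (EFin \o (fun x => h x * phi x ^+ 2)).
Proof.
rewrite (_ : _ \o _ = fun x => ((h x * phi x) * phi x)%:E).
  by apply: (L2_integrableM mO) => //; exact: continuous_L2.
by apply/funext => x /=; rewrite expr2 mulrA.
Qed.

Lemma weighted_perp_poincare :
  \int[mu]_(x in Omega) (h x * phi x ^+ 2) <=
  4 * \int[mu]_(x in Omega) (h x * dot (G x) (G x)).
Proof.
have iG := integrable_weight_dot_sqr; have ih := integrable_weight_sqr.
have := weighted_energy_le oO bO dbn cJ JM lambda0 bnw lambda_large tphi.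
rewrite weight_dot_perp_grad => H.
suff : - 2 * \int[mu]_(x in Omega) (h x * phi x * dot (bn x) (G x)) <=
    2^-1 * \int[mu]_(x in Omega) (h x * phi x ^+ 2) +
    2 * \int[mu]_(x in Omega) (h x * dot (G x) (G x)) by lra.
have iw := integrable_weight_dot.
have i1 := integrableZl mO 2^-1 ih; have i2 := integrableZl mO 2 iG.
rewrite -!RintegralZl// -RintegralD//.
apply: le_Rintegral => //.
- exact: (integrableZl mO (- 2) iw).
- exact: (integrableD mO i1 i2).
move=> x Ox; have := dot_sqr_le (G x) (bn1 Ox).
have : 0 < h x by exact: expR_gt0.
move: (h x) (phi x) (dot (bn x) (G x)) (dot (G x) (G x)) => a p s q a0 sq.
have -> : 2^-1 * (a * p ^+ 2) + 2 * (a * q) = a * (2^-1 * p ^+ 2 + 2 * q) by ring.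
have -> : - 2 * (a * p * s) = a * (- 2 * p * s) by ring.
(* Half of [(p + 2 s)^2 >= 0] is [- 2 p s <= p^2 / 2 + 2 s^2], and [s^2 <= q] because [bn x] is a
   unit vector. *)
rewrite ler_pM2l//; have := sqr_ge0 (p + 2 * s); nra.
Qed.

(** On [Omega] the weight lies between [expR (- S)] and [expR S], so removing it from both sides
    costs the ratio of these bounds. *)
Lemma perp_poincare_test (S : R) : (forall x, Omega x -> `|lambda * dot x w| <= S) ->
  \int[mu]_(x in Omega) (phi x ^+ 2) <=
  4 * expR S / expR (- S) * \int[mu]_(x in Omega) dot (G x) (G x).
Proof.
move=> SO.
have hS x : Omega x -> expR (- S) <= h x <= expR S.
  by move=> /SO; rewrite ler_norml /exp_weight !ler_expR.
have iG := integrable_dot_sqr mO GL.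
have iphi : mu.-integrable Omega (EFin \o (fun x => phi x ^+ 2)).
  by apply: (L2_integrable_sqr mO); exact: continuous_L2.
rewrite mulrAC ler_pdivlMr ?expR_gt0// mulrC -RintegralZl//.
apply: (@le_trans _ _ (\int[mu]_(x in Omega) (h x * phi x ^+ 2))).
  apply: le_Rintegral => //.
  - exact: (integrableZl mO (expR (- S)) iphi).
  - exact: integrable_weight_sqr.
  - by move=> x /hS /andP[hx _]; rewrite ler_wpM2r ?sqr_ge0.
apply: (le_trans weighted_perp_poincare).
rewrite -mulrA ler_pM2l// -RintegralZl//; apply: le_Rintegral => //.
- exact: integrable_weight_dot_sqr.
- exact: (integrableZl mO (expR S) iG).
- by move=> x /hS /andP[_ hx]; rewrite ler_wpM2r ?dot_ge0.
Qed.

End estimate.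

Lemma sqrtr_le_limit (R : realType) (a c K : R) : 0 <= K ->
  (forall eps : R, 0 < eps -> a <= c + K * eps ^+ 2) -> a <= c.
Proof.
move=> K0 aK; apply/ler_addgt0Pl => e e0; rewrite addrC.
(* The square of the [eps] used below; dividing by [K + 1] rather than [K] covers the case
   [K = 0]. *)
have s0 : 0 < e / (K + 1) by rewrite divr_gt0// ltr_wpDl.
apply: le_trans (aK (Num.sqrt (e / (K + 1))) _) _; first by rewrite sqrtr_gt0.
rewrite lerD2l sqr_sqrtr ?(ltW s0)// mulrCA ger_pMr// ler_pdivrMr ?ltr_wpDl//.
by rewrite mul1r lerDl.
Qed.

Theorem corollary3p4 (R : realType) (n : nat) (hn : (2 <= n.+1)%N)
    (Omega : set 'rV[R]_n.+1)
    (domOmega : domain Omega)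
    (bndOmega : bounded_set Omega)
    (lipOmega : lipschitz_boundary Omega)
    (bn : 'rV[R]_n.+1 -> 'rV[R]_n.+1)
    (C1bn : C1_bounded_differential bn)
    (alpha : R) (alpha0 : 0 < alpha)
    (hw : exists w : 'rV[R]_n.+1, forall x, alpha <= dot (bn x) w) :
  exists2 CP : R, 0 < CP &
    forall (b : 'rV[R]_n.+1 -> 'rV[R]_n.+1)
           (B : 'I_n.+1 -> 'rV[R]_n.+1 -> 'rV[R]_n.+1),
      [lipschitz b x | x in Omega] ->
      (forall i, [lipschitz B i x | x in Omega]) ->
      orthonormal_frame B Omega ->
      (forall x, Omega x -> B ord0 x = b x) ->
      (forall x, Omega x -> B ord_max x = bn x) ->
      forall (v : 'rV[R]_n.+1 -> R) (g : 'rV[R]_n.+1 -> 'rV[R]_n.+1),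
        H1perp0 Omega b v -> is_perp_grad Omega b v g ->
        (L2norm Omega v <= CP%:E * L2vecnorm Omega g)%E.
Proof.
have [oO _ _] := domOmega; have mO := measurable_open_rV oO.
have [dbn cJ [M JM]] := C1bn; have [w bnw] := hw.
have M0 : 0 <= M by exact: le_trans (normr_ge0 _) (JM 0).
(* [n.+1%:R * M] compensates the divergence of [bn]; the extra 1 is the coefficient with which h
   phi^2 survives. *)
pose lambda := (n.+1%:R * M + 1) / alpha.
have lambda0 : 0 <= lambda by rewrite divr_ge0 ?(ltW alpha0)// addr_ge0// mulr_ge0.
have lambda_large : n.+1%:R * M + 1 <= lambda * alpha by rewrite divfK// gt_eqF.
have [S SO] : exists S, forall x, Omega x -> `|lambda * dot x w| <= S.
  apply: continuous_bounded_on bndOmega.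
  apply: (@continuous_funM _ _ (fun=> lambda)); last exact: continuous_dotr.
  by move=> y; exact: cst_continuous.
pose C := 4 * expR S / expR (- S).
have C0 : 0 < C by rewrite !(mulr_gt0, invr_gt0) ?expR_gt0.
(* [C] is the constant for test functions. One factor 2 comes from splitting [v] into [v - phi] and
   [phi], the other from splitting [G] into [g] and [g']. *)
exists (Num.sqrt (4 * C)); first by rewrite sqrtr_gt0 mulr_gt0.
move=> b B lipb lipB Borth Bb Bbn v g [[vL _] vapprox] vg.
have gL := vg.1.
rewrite (L2norm_sqrt mO (L2_integrable_sqr mO vL)) (L2vecnorm_sqrt mO gL) -EFinM lee_fin.
rewrite -sqrtrM ?mulr_ge0 ?(ltW C0)//; apply: ler_wsqrtr.
have approx (eps : R) : 0 < eps -> exists phi g', [/\ test_function Omega phi,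
   is_perp_grad Omega b (fun x => v x - phi x) g',
   \int[lebesgue_rV R n.+1]_(x in Omega) (v x - phi x) ^+ 2 <= eps ^+ 2 &
   \int[lebesgue_rV R n.+1]_(x in Omega) dot (g' x) (g' x) <= eps ^+ 2].
  move=> eps0; have [phi [g' [tphi g'P]]] := vapprox eps eps0.
  have pL : L2 Omega phi by apply: smooth_L2 => //; case: tphi.
  have vpL : L2 Omega (fun x => v x - phi x) by exact: L2B.
  rewrite /H1perp_norm (L2norm_sqrt mO (L2_integrable_sqr mO vpL)) (L2vecnorm_sqrt mO g'P.1).
  have v0 : 0 <= \int[lebesgue_rV R n.+1]_(x in Omega) (v x - phi x) ^+ 2.
    by apply: Rintegral_ge0 => x _; exact: sqr_ge0.
  have g0 : 0 <= \int[lebesgue_rV R n.+1]_(x in Omega) dot (g' x) (g' x).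
    by apply: Rintegral_ge0 => x _; exact: dot_ge0.
  rewrite -!EFin_expe -EFinD poweR_EFin !sqr_sqrtr// powR12_sqrt ?addr_ge0// lte_fin.
  rewrite -[X in _ < X -> _](gtr0_norm eps0) -sqrtr_sqr ltr_sqrt ?exprn_gt0// => vge.
  by exists phi, g'; split => //; apply: ltW; apply: le_lt_trans vge; rewrite ?lerDl ?lerDr.
have b1 x : Omega x -> dot (b x) (b x) = 1.
  by move=> Ox; rewrite -Bb// (Borth x Ox) eqxx.
have bn1 x : Omega x -> dot (bn x) (bn x) = 1.
  by move=> Ox; rewrite -Bbn// (Borth x Ox) eqxx.
have bnb x : Omega x -> dot (bn x) (b x) = 0.
  move=> Ox; rewrite -Bbn// -Bb// (Borth x Ox) -val_eqE /=.
  (* Dimension at least 2 makes the first and the last index of the frame distinct. *)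
  by rewrite (_ : n == 0 = false)//; case: (n) hn.
have mb i := lipschitz_measurable_coord i oO lipb.
(* The total coefficient of [eps ^+ 2]: 2 from [v - phi], and [2 * C * 2] from [g']. *)
apply: (@sqrtr_le_limit _ _ _ (2 + 4 * C)) => [|eps eps0].
  by rewrite addr_ge0// mulr_ge0// ltW.
have [phi [g' [tphi g'P vphi g'eps]]] := approx eps eps0.
have g'L := g'P.1.
have pL : L2 Omega phi by apply: smooth_L2 => //; case: tphi.
have vpL : L2 Omega (fun x => v x - phi x) by exact: L2B.
(* The candidate for the perpendicular gradient of [phi]: [g] belongs to [v] and [g'] to
   [v - phi]. *)
pose G x := g x - g' x.
have GL : L2vec Omega G.
  move=> i; rewrite (_ : (fun _ => _) = fun x => g x ord0 i - g' x ord0 i).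
    exact: L2B.
  by apply/funext => x; rewrite !mxE.
have vtest (e : R) : 0 < e -> exists2 psi, test_function Omega psi &
    \int[lebesgue_rV R n.+1]_(x in Omega) (v x - psi x) ^+ 2 <= e ^+ 2.
  by move=> e0; have [psi [? [? _ ? _]]] := approx e e0; exists psi.
have Gphi i psi : test_function Omega psi ->
    \int[lebesgue_rV R n.+1]_(x in Omega) (G x ord0 i * psi x) =
    \sum_j \int[lebesgue_rV R n.+1]_(x in Omega)
      (perp_proj (b x) i j * psi x * partial j phi x).
  move=> tpsi; rewrite -(perp_grad_test oO bndOmega vtest vL tphi vg g'P i tpsi).
  have psiL : L2 Omega psi by apply: smooth_L2 => //; case: tpsi.
  rewrite -RintegralB//; [|exact: L2_integrableM|exact: L2_integrableM].
  by apply: eq_Rintegral => x _; rewrite !mxE mulrBl.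
have phiG := perp_poincare_test oO bndOmega dbn cJ JM lambda0 bnw lambda_large
  mb b1 bn1 bnb tphi GL Gphi SO.
have Gg : \int[lebesgue_rV R n.+1]_(x in Omega) dot (G x) (G x) <=
    2 * \int[lebesgue_rV R n.+1]_(x in Omega) dot (g x) (g x) + 2 * eps ^+ 2.
  apply: (@le_trans _ _ (2 * \int[lebesgue_rV R n.+1]_(x in Omega) dot (g x) (g x) +
    2 * \int[lebesgue_rV R n.+1]_(x in Omega) dot (g' x) (g' x))); last first.
    by rewrite lerD2l ler_pM2l.
  have ig := integrable_dot_sqr mO gL; have ig' := integrable_dot_sqr mO g'L.
  rewrite -!RintegralZl// -RintegralD//; [|exact: (integrableZl mO 2 ig)|exact: (integrableZl mO 2 ig')].
  apply: le_Rintegral => //; first exact: integrable_dot_sqr.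
    exact: (integrableD mO (integrableZl mO 2 ig) (integrableZl mO 2 ig')).
  by move=> x _; exact: dot_sqrB_le.
have vv : \int[lebesgue_rV R n.+1]_(x in Omega) (v x ^+ 2) <=
    2 * eps ^+ 2 + 2 * \int[lebesgue_rV R n.+1]_(x in Omega) (phi x ^+ 2).
  apply: (@le_trans _ _ (2 * \int[lebesgue_rV R n.+1]_(x in Omega) ((v x - phi x) ^+ 2) +
    2 * \int[lebesgue_rV R n.+1]_(x in Omega) (phi x ^+ 2))); last first.
    by rewrite lerD2r ler_pM2l.
  have i1 := L2_integrable_sqr mO vpL; have i2 := L2_integrable_sqr mO pL.
  rewrite -!RintegralZl// -RintegralD//; [|exact: (integrableZl mO 2 i1)|exact: (integrableZl mO 2 i2)].
  apply: le_Rintegral => //; first exact: L2_integrable_sqr.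
    exact: (integrableD mO (integrableZl mO 2 i1) (integrableZl mO 2 i2)).
  by move=> x _; have := sqr_ge0 (v x - 2 * phi x); nra.
have := ler_wpM2l (ltW C0) Gg; rewrite -/C in phiG; lra.
Qed.
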